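(* For any closure operator $f:2^E\to 2^E$ on a finite set $E$, the bases $\mathcal{B}(f)$ index a collection of homology facets for the augmented Bergman complex $\Delta_f$ (the basis $B$ indexing the simplex $\{y_i\}_{i\in B}$). Hence $\Delta_f$ is homotopy equivalent to a wedge of spheres $$\bigvee_{B\in\mathcal{B}(f)}\mathbb{S}^{\#B-1},$$ and the action of $\mathrm{Aut}(f)$ on $\tilde{H}_i(\Delta_f,\mathbb{Z})$ is the same as its action on $\mathrm{span}_{\mathbb{Z}}\{[B]: B\in\mathcal{B}(f),\ \#B-1=i\}$ within the oriented simplicial chain group $\tilde{C}_i(\Delta_f,\mathbb{Z})$.
   Context: A closure operator on a set $E$ is a map $f:2^E\to2^E$ such that for all $A,B\subseteq E$: $A\subseteq f(A)$; $A\subseteq B$ implies $f(A)\subseteq f(B)$; and $f(f(A))=f(A)$. For a closure operator $f$ on a finite set $E$: - A subset $I\subseteq E$ is independent if $f(I\setminus\{i\})\subsetneq f(I)$ for all $i\in I$; $\mathcal{I}(f)$ is the collection of all independent subsets. - $\mathcal{F}(f)=\{F\subseteq E: f(F)=F\}$ is the poset of closed sets, ordered by inclusion. - $\mathcal{B}(f)=\{B\in\mathcal{I}(f): f(B)=E\}$ is the set of bases. - The augmented Bergman complex $\Delta_f$ is the abstract simplicial complex on vertex set $\{y_i:i\in E\}\sqcup\{x_F:F\in\mathcal{F}(f)\setminus\{E\}\}$ whose simplices are the subsets $\{y_i\}_{i\in I}\cup\{x_{F_1},\ldots,x_{F_\ell}\}$ with $I\in\mathcal{I}(f)$, $\ell\ge0$,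 and closed sets $F_j\in\mathcal{F}(f)$ satisfying $I\subseteq F_1\subsetneq F_2\subsetneq\cdots\subsetneq F_\ell\ (\subsetneq E)$. - $\mathrm{Aut}(f)=\{\text{bijections }g:E\to E : f(g(A))=g(f(A))\text{ for all }A\subseteq E\}$. It acts on $\Delta_f$ by simplicial automorphisms, $y_i\mapsto y_{g(i)}$, $x_F\mapsto x_{g(F)}$, and stabilizes $\mathcal{B}(f)$. A facet of a simplicial complex is an inclusion-maximal simplex. A collection $\mathcal{B}$ of facets of a simplicial complex $\Delta$ is called a set of homology facets if the subcomplex $\Delta\setminus\mathcal{B}$ obtained by removing them is contractible. For a simplicial complex $\Delta$, $\tilde{C}_i(\Delta,\mathbb{Z})$ is the free abelian group with one basis element $[v_0,\ldots,v_i]$ (an oriented simplex) for each $i$-dimensional simplex with a fixed reference ordering of its vertices, with $[v_{w(0)},\ldots,v_{w(i)}]=\mathrm{sgn}(w)\,[v_0,\ldots,v_i]$ for permutations $w$; simplicial automorphisms $g$ act by $g[v_0,\ldots,v_i]=[g(v_0),\ldots,g(v_i)]$. For a basis $B$, $[B]$ denotes the oriented simplex on the vertices $\{y_i\}_{i\in B}$. $\tilde{H}_i$ denotes reduced simplicial homology. *)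

(* Defs.v *)
From HB Require Import structures.
From mathcomp Require Import all_boot all_order all_fingroup all_algebra.
From mathcomp Require Import generic_quotient ring_quotient.
From mathcomp Require Import all_classical all_reals all_analysis homotopy.

Set Implicit Arguments.
Unset Strict Implicit.
Unset Printing Implicit Defensive.

Import Order.TTheory GRing.Theory Num.Theory.
Import numFieldNormedType.Exports.

Local Open Scope ring_scope.
Local Open Scope quotient_scope.

Section Homotopy.
Local Open Scope classical_set_scope.
Variable R : realType.

Definition homotopic (X Y : topologicalType) (f g : X -> Y) : Prop :=
  exists H : X * R -> Y,
    [/\ {within [set: X] `*` `[0, 1], continuous H},
        forall x, H (x, 0) = f x
      & forall x, H (x, 1) = g x].

Definition homotopy_equivalent (X Y : topologicalType) : Prop :=
  exists (f : X -> Y) (g : Y -> X),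
    [/\ continuous f, continuous g,
        homotopic (g \o f) idfun & homotopic (f \o g) idfun].

Definition contractible (X : topologicalType) : Prop :=
  exists x0 : X, homotopic idfun (fun _ : X => x0).

(* The unit sphere of R^n, i.e. the sphere of dimension n - 1; it is empty for
   n = 0, in accordance with the convention for the (-1)-sphere. *)
Definition sphere (n : nat) : topologicalType :=
  ([set x : 'rV[R]_n | \sum_(j < n) x ord0 j ^+ 2 = 1] : Type).

End Homotopy.

(* A finite abstract simplicial complex is given by its set of simplices, the
   empty simplex included.  Elements of the ambient type V need not be vertices
   of the complex. *)

Section Complex.
Variables (R : realType) (V : finType).
Implicit Types (K BB : {set {set V}}) (S : {set V}).

(* points in barycentric coordinates, with the topology of R^V *)
Definition realization K : topologicalType :=
  ([set t : {ptws V -> R} | [/\ forall v, 0 <= t v, \sum_v t v = 1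
      & [set v | t v != 0]%SET \in K]]%classic : Type).

Definition facets K : {set {set V}} := [set S | maxset [in K] S].

(* The void complex, which has no simplex at all, counts as contractible; this
   is distinct from the complex [set set0] = {emptyset}, which does not.  The
   convention matters only when the single facet of {emptyset} is removed. *)
Definition contractible_complex K : Prop :=
  K = finset.set0 \/ contractible R (realization K).

Definition homology_facets K BB : Prop :=
  BB \subset facets K /\ contractible_complex (K :\: BB).

End Complex.

Section Chains.
Variable V : finType.
Implicit Types (K : {set {set V}}) (S : {set V}) (i : int).

(* Integral combinations of subsets of V.  The basis element attached to S
   stands for S oriented by its reference ordering [enum S]. *)
Definition chain := {ffun {set V} -> int}.
HB.instance Definition _ := GRing.Zmodule.on chain.

(* The oriented simplex [v_0, ..., v_(n-1)]: if [v \o w] is the reference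
   ordering of S, then it is sgn(w) times the basis element of S.  It vanishes
   when v has a repetition. *)
Definition oriented n (v : 'I_n -> V) : chain :=
  [ffun S : {set V} =>
    \sum_(w : 'S_n | codom (v \o w) == enum S) (-1) ^+ w].

(* [enum_val] is the reference ordering of S *)
Definition boundary (c : chain) : chain :=
  \sum_(S : {set V}) \sum_(j < #|S|)
    oriented (@enum_val _ (mem S) \o lift j) *~ ((-1) ^+ j * c S).

Definition chain_act (g : V -> V) (c : chain) : chain :=
  \sum_(S : {set V}) oriented (g \o @enum_val _ (mem S)) *~ c S.

(* The i-dimensional chains; the empty simplex has dimension -1. *)
Definition chains K i : {pred chain} :=
  [pred c : chain |
    [forall S, (c S != 0) ==> (S \in K) && (#|S|%:Z - 1 == i)]].

Definition cycles K i : {pred chain} :=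
  [pred c | (c \in chains K i) && (boundary c == 0)].

Lemma boundary_zmod : zmod_morphism boundary.
Proof.
move=> c d; rewrite /boundary -sumrB; apply: eq_bigr => S _.
rewrite -sumrB; apply: eq_bigr => j _.
by rewrite ffunE [X in _ + X]ffunE mulrBr mulrzBr.
Qed.
HB.instance Definition _ :=
  GRing.isZmodMorphism.Build chain chain boundary boundary_zmod.

Lemma chain_act_zmod g : zmod_morphism (chain_act g).
Proof.
move=> c d; rewrite /chain_act -sumrB; apply: eq_bigr => S _.
by rewrite ffunE [X in _ + X]ffunE mulrzBr.
Qed.
HB.instance Definition _ g :=
  GRing.isZmodMorphism.Build chain chain (chain_act g) (chain_act_zmod g).

Lemma chains_zmod K i : zmod_closed (chains K i).
Proof.
split=> [|c d /forallP cK /forallP dK].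
  by apply/forallP => S; rewrite ffunE eqxx.
apply/forallP => S; apply/implyP; rewrite ffunE [X in _ + X]ffunE.
have [c0|cS _] := eqVneq (c S) 0; last by have := cK S; rewrite cS.
by rewrite c0 sub0r oppr_eq0 => dS; have := dK S; rewrite dS.
Qed.
HB.instance Definition _ K i :=
  GRing.isZmodClosed.Build chain (chains K i) (chains_zmod K i).

Lemma cycles_zmod K i : zmod_closed (cycles K i).
Proof.
split=> [|c d /andP[cK /eqP c0] /andP[dK /eqP d0]].
  by rewrite inE rpred0 raddf0 eqxx.
by rewrite inE rpredB //= raddfB /= c0 d0 subrr eqxx.
Qed.
HB.instance Definition _ K i :=
  GRing.isZmodClosed.Build chain (cycles K i) (cycles_zmod K i).

Record cycle K i := Cycle {
  cycle_val : chain;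
  cycleP : cycle_val \in cycles K i
}.
HB.instance Definition _ K i := [isSub for @cycle_val K i].
HB.instance Definition _ K i := [Choice of cycle K i by <:].
HB.instance Definition _ K i := [SubChoice_isSubZmodule of cycle K i by <:].

Definition boundaries K i : {pred cycle K i} :=
  fun z => `[< exists2 d, d \in chains K (i + 1) & boundary d = val z >].

Lemma boundaries_zmod K i : zmod_closed (@boundaries K i).
Proof.
split=> [|y z /asboolP[c cK cy] /asboolP[d dK dz]]; apply/asboolP.
  by exists 0; rewrite ?rpred0 // !raddf0.
by exists (c - d); rewrite ?rpredB // !raddfB /= cy dz.
Qed.
HB.instance Definition _ K i :=
  GRing.isZmodClosed.Build (cycle K i) (@boundaries K i) (boundaries_zmod K i).

Definition homology K i : zmodType := Quotient.quot (@boundaries K i).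

Definition simplicial_aut K : {set {perm V}} :=
  [set g : {perm V} | [forall S : {set V}, (g @: S \in K) == (S \in K)]].

Lemma chainMzE (c : chain) (z : int) S : (c *~ z) S = c S * z.
Proof.
case: z => m.
  by change ((c *+ m) S = c S * m%:Z); rewrite ffunMnE -mulr_natr natz.
change ((- (c *+ m.+1)) S = c S * Negz m).
by rewrite NegzE mulrN ffunE ffunMnE -mulr_natr natz.
Qed.

Lemma oriented_perm n (v : 'I_n -> V) (w : 'S_n) :
  oriented (v \o w) = oriented v *~ (-1) ^+ w.
Proof.
apply/ffunP => S; rewrite chainMzE !ffunE mulr_suml.
rewrite (reindex_inj (mulIg (w^-1)%g)) /=.
apply: eq_big => [u|u _]; last by rewrite odd_permM odd_permV signr_addb.
by congr (_ == _); apply: eq_codom => i /=; rewrite permM permKV.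
Qed.

Lemma codom_ref S (g : V -> V) (w : 'S_#|S|) (T : {set V}) :
  codom (g \o @enum_val _ (mem S) \o w) = enum T -> T = g @: S.
Proof.
move=> eST; apply/setP => x; rewrite -mem_enum -eST.
apply/codomP/imsetP => [[i ->]|[y yS ->]].
  by exists (enum_val (w i)) => //; apply: enum_valP.
exists (w^-1 (enum_rank_in yS y))%g => /=.
by rewrite permKV enum_rankK_in.
Qed.

Lemma codom_enum_val S : codom (@enum_val _ (mem S)) = enum S.
Proof.
have szE : size (codom (@enum_val _ (mem S))) = size (enum S).
  by rewrite size_codom card_ord -cardE.
have [S0|/set0Pn[x0 _]] := eqVneq S finset.set0.
  have sz0 : size (enum S) = 0%N by rewrite S0 -cardE cards0.
  by rewrite (size0nil sz0) (size0nil (etrans szE sz0)).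
apply: (@eq_from_nth _ x0) => // k; rewrite size_codom card_ord => lt_k.
rewrite codomE (nth_map (Ordinal lt_k)) ?size_enum_ord //.
by rewrite (nth_ord_enum _ (Ordinal lt_k)) (enum_val_nth x0).
Qed.

Lemma oriented_ref S :
  oriented (@enum_val _ (mem S)) = [ffun T => (T == S)%:R].
Proof.
apply/ffunP => T; rewrite !ffunE; have [->|neTS] := eqVneq T S; last first.
  rewrite big1 // => w /eqP eT; case/eqP: neTS.
  by rewrite (@codom_ref S id w T eT) imset_id.
rewrite (big_pred1 1%g) ?odd_perm1 ?expr0 // => w.
apply/eqP/eqP => [|->]; last first.
  by rewrite -[RHS]codom_enum_val; apply: eq_codom => i /=; rewrite perm1.
rewrite -[RHS]codom_enum_val => /eq_in_map wE; apply/permP => i.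
by apply: enum_val_inj; rewrite perm1; apply: wE; rewrite mem_enum.
Qed.

Lemma chain_decomp (c : chain) :
  c = \sum_(S : {set V}) oriented (@enum_val _ (mem S)) *~ c S.
Proof.
apply/ffunP => T; rewrite sum_ffunE (bigD1 T) //= chainMzE oriented_ref ffunE.
rewrite eqxx mul1r big1 ?addr0 // => S neST.
by rewrite chainMzE oriented_ref ffunE eq_sym (negPf neST) mul0r.
Qed.

Lemma oriented_std n (v : 'I_n -> V) : injective v ->
  exists (S : {set V}) (e : n = #|S|) (w : 'S_#|S|),
    v = @enum_val _ (mem S) \o w \o cast_ord e.
Proof.
move=> v_inj; pose S := [set v k | k in 'I_n].
have e : n = #|S| by rewrite card_imset // card_ord.
have vS (k : 'I_n) : v k \in enum S by rewrite mem_enum imset_f.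
have ltS (k : 'I_n) : (index (v k) (enum S) < #|S|)%N by rewrite cardE index_mem.
pose h k := Ordinal (ltS (cast_ord (esym e) k)).
have h_inj : injective h.
  move=> k l /(congr1 val) /= /(congr1 (nth (v (cast_ord (esym e) k)) (enum S))).
  by rewrite !nth_index // => /v_inj /cast_ord_inj.
exists S, e, (perm h_inj); apply/funext => k /=.
by rewrite permE (enum_val_nth (v k)) /= cast_ordK nth_index.
Qed.

Lemma lift_permE n (w : 'S_n) (j : 'I_n) :
  exists2 w' : 'S_n.-1, w \o lift j =1 lift (w j) \o w' &
    (-1) ^+ w' = (-1) ^+ w * (-1) ^+ j * (-1) ^+ w j :> int.
Proof.
case: n => [|n] in w j *; first by case: j.
pose h k := odflt k (unlift (w j) (w (lift j k))).
have hE k : w (lift j k) = lift (w j) (h k).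
  rewrite /h; case: unliftP => //= /perm_inj /eqP.
  by rewrite eq_sym (negPf (neq_lift _ _)).
have h_inj : injective h.
  by move=> k l hkl; apply/(@lift_inj _ j)/(@perm_inj _ w); rewrite !hE hkl.
exists (perm h_inj) => [k|]; first by rewrite /= permE hE.
have {1}-> : w = lift_perm j (w j) (perm h_inj).
  apply/permP => k; case: (unliftP j k) => [l ->|->].
    by rewrite lift_perm_lift permE hE.
  by rewrite lift_perm_id.
rewrite odd_lift_perm -(signr_odd _ j) -(signr_odd _ (w j)) -!signr_addb.
by rewrite -addbA [_ (+) perm h_inj]addbC -addbA addbb addbF.
Qed.

Lemma boundary_ref S : boundary (oriented (@enum_val _ (mem S))) =
  \sum_(j < #|S|) oriented (@enum_val _ (mem S) \o lift j) *~ (-1) ^+ j.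
Proof.
rewrite /boundary (bigD1 S) //= [X in _ + X]big1 => [|T neTS]; last first.
  by rewrite big1 // => j _; rewrite oriented_ref ffunE (negPf neTS) mulr0 mulr0z.
by rewrite addr0; apply: eq_bigr => j _; rewrite oriented_ref ffunE eqxx mulr1.
Qed.

Lemma boundary_oriented n (v : 'I_n -> V) : injective v ->
  boundary (oriented v) = \sum_(j < n) oriented (v \o lift j) *~ (-1) ^+ j.
Proof.
move=> /oriented_std[S [e [w ->]]]; subst n.
have castE : cast_ord (erefl #|S|) = id by apply/funext => k; rewrite cast_ord_id.
rewrite castE (oriented_perm _ w) raddfMz /= boundary_ref.
rewrite (reindex_inj (@perm_inj _ w)) /=.
transitivity (\sum_j oriented (@enum_val _ (mem S) \o lift (w j))
                *~ (-1) ^+ (w j) *~ (-1) ^+ w).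
  by apply/ffunP => T; rewrite chainMzE !sum_ffunE mulr_suml;
     apply: eq_bigr => j _; rewrite !chainMzE.
apply: eq_bigr => j _; have [w' ww' sgnw'] := lift_permE w j.
have -> : @enum_val _ (mem S) \o w \o id \o lift j =
          @enum_val _ (mem S) \o lift (w j) \o w'.
  by apply/funext => k; congr enum_val; apply: ww'.
rewrite (oriented_perm _ w') -!mulrzA sgnw'; congr (_ *~ _).
by rewrite [RHS]mulrAC -[_ * _ * (-1) ^+ j]mulrA -expr2 sqrr_sign mulr1 mulrC.
Qed.

Lemma chain_act_ref (g : V -> V) S :
  chain_act g (oriented (@enum_val _ (mem S))) =
  oriented (g \o @enum_val _ (mem S)).
Proof.
rewrite /chain_act (bigD1 S) //= oriented_ref ffunE eqxx mulr1z big1 ?addr0 //.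
by move=> T neTS; rewrite ffunE (negPf neTS) mulr0z.
Qed.

Lemma chain_act_oriented n (g : V -> V) (v : 'I_n -> V) : injective v ->
  chain_act g (oriented v) = oriented (g \o v).
Proof.
move=> /oriented_std[S [e [w ->]]]; subst n.
have castE : cast_ord (erefl #|S|) = id by apply/funext => k; rewrite cast_ord_id.
rewrite castE (oriented_perm _ w) raddfMz /= chain_act_ref.
exact/esym/(oriented_perm (g \o _) w).
Qed.

Lemma chain_act_boundary (g : V -> V) (c : chain) : injective g ->
  boundary (chain_act g c) = chain_act g (boundary c).
Proof.
pose bd : {additive chain -> chain} := boundary.
pose act : {additive chain -> chain} := chain_act g.
move=> g_inj; suff /(_ c) : bd \o act =1 act \o bd by [].
move=> {}c; rewrite (chain_decomp c) !raddf_sum; apply: eq_bigr => S _.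
rewrite !raddfMz; congr (_ *~ _); rewrite /= /act /bd /=.
have ref_inj : injective (@enum_val _ (mem S)) by exact: enum_val_inj.
rewrite chain_act_ref boundary_ref boundary_oriented; last exact: inj_comp.
rewrite raddf_sum; apply: eq_bigr => j _; rewrite raddfMz /=; congr (_ *~ _).
rewrite chain_act_oriented //; apply: inj_comp => //; exact: lift_inj.
Qed.

Lemma chain_act_chains K i (g : {perm V}) (c : chain) :
  g \in simplicial_aut K -> c \in chains K i -> chain_act g c \in chains K i.
Proof.
rewrite inE => /forallP gK /forallP cK; apply/forallP => T; apply/implyP.
rewrite /chain_act sum_ffunE; apply: contraNT => TK.
rewrite big1 // => S _; rewrite chainMzE ffunE.
have [->|cS] := eqVneq (c S) 0; first by rewrite mulr0.
rewrite big1 ?mul0r // => w /eqP/codom_ref TE; case/negP: TK.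
rewrite TE (eqP (gK S)) card_imset; last exact: perm_inj.
by have := cK S; rewrite cS.
Qed.


Lemma cycle_act_subproof K i (g : {perm V}) (gK : g \in simplicial_aut K)
  (z : cycle K i) : chain_act g (val z) \in cycles K i.
Proof.
have /andP[zK /eqP z0] := cycleP z.
rewrite inE chain_act_chains //= chain_act_boundary; last exact: perm_inj.
by rewrite [boundary _]z0 raddf0.
Qed.

Definition cycle_act K i (g : {perm V}) (gK : g \in simplicial_aut K)
    (z : cycle K i) : cycle K i :=
  Cycle (cycle_act_subproof gK z).

Definition homology_act K i (g : {perm V}) (gK : g \in simplicial_aut K)
    (h : homology K i) : homology K i :=
  \pi_(homology K i) (cycle_act gK (repr h)).

Lemma homology_act_pi K i (g : {perm V}) (gK : g \in simplicial_aut K)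
    (z : cycle K i) :
  homology_act gK (\pi z) = \pi_(homology K i) (cycle_act gK z).
Proof.
apply/eqP; rewrite /homology_act -Quotient.idealrBE.
have : repr (\pi_(homology K i) z) - z \in @boundaries K i.
  by rewrite Quotient.idealrBE reprK.
move=> /asboolP[d dK dz]; apply/asboolP; exists (chain_act g d).
  exact: chain_act_chains.
by rewrite chain_act_boundary ?dz; [rewrite !raddfB|exact: perm_inj].
Qed.

End Chains.

Definition closure_operator (E : finType) (f : {set E} -> {set E}) : Prop :=
  [/\ forall A : {set E}, A \subset f A,
      forall A B : {set E}, A \subset B -> f A \subset f B
    & forall A : {set E}, f (f A) = f A].

Section Bergman.
Variables (E : finType) (f : {set E} -> {set E}).

Definition independents : {set {set E}} :=
  [set I : {set E} | [forall i in I, f (I :\ i) \proper f I]].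

Definition flats : {set {set E}} := [set F | f F == F].

Definition bases : {set {set E}} := [set B in independents | f B == [set: E]].

(* The vertices y_i are [inl i] and the vertices x_F are [inr F]; for
   F not closed or F = E, [inr F] lies in no simplex. *)
Definition bergman_vertex : finType := (E + {set E})%type.

Definition bergman_simplex (I : {set E}) (FF : {set {set E}}) :
    {set bergman_vertex} :=
  [set inl i | i in I] :|: [set inr F | F in FF].

Definition flag (FF : {set {set E}}) : bool :=
  (FF \subset flats :\ [set: E]) &&
  [forall F in FF, forall G in FF, (F \subset G) || (G \subset F)].

Definition bergman : {set {set bergman_vertex}} :=
  [set bergman_simplex I FF | I in independents, FF in flag &
     [forall F in FF, I \subset F]].

Definition basis_simplex (B : {set E}) : {set bergman_vertex} :=
  [set inl i | i in B].

Definition basis_chain (B : {set E}) : chain bergman_vertex :=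
  oriented (fun j : 'I_#|B| => inl (enum_val j)).

Definition basis_span (i : int) (c : chain bergman_vertex) : Prop :=
  exists a : {set E} -> int,
    c = \sum_(B in bases | #|B|%:Z - 1 == i) basis_chain B *~ a B.

Definition closure_aut : {set {perm E}} :=
  [set g : {perm E} | [forall A : {set E}, f (g @: A) == g @: f A]].

Definition vertex_map (g : {perm E}) (v : bergman_vertex) : bergman_vertex :=
  match v with inl i => inl (g i) | inr F => inr (g @: F) end.

Lemma vertex_map_inj g : injective (vertex_map g).
Proof.
by move=> [i|F] [j|G] //= []; [move=> /perm_inj -> |
  move=> /(imset_inj (@perm_inj _ g)) ->].
Qed.

Definition vertex_perm (g : {perm E}) : {perm bergman_vertex} :=
  perm (@vertex_map_inj g).

Lemma vertex_perm_simplex g I FF : vertex_perm g @: bergman_simplex I FF =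
  bergman_simplex (g @: I) [set g @: (F : {set E}) | F in FF].
Proof.
rewrite /bergman_simplex imsetU -!imset_comp.
by congr (_ :|: _); apply: eq_imset => x /=; rewrite permE.
Qed.

Lemma vertex_perm_bergman g S : g \in closure_aut ->
  S \in bergman -> vertex_perm g @: S \in bergman.
Proof.
rewrite inE => /forallP gf /imset2P[I FF].
have {}gf (A : {set E}) : f (g @: A) = g @: f A by exact/eqP.
have g_inj : injective g by exact: perm_inj.
rewrite inE => /forall_inP II; rewrite inE => /andP[/andP[/fintype.subsetP FFf FFc] IF] ->.
rewrite vertex_perm_simplex; apply: imset2_f.
  rewrite inE; apply/forall_inP => _ /imsetP[i iI ->].
  have -> : g @: I :\ g i = g @: (I :\ i).
    apply/setP => x; rewrite !inE; apply/andP/imsetP => [[xNi /imsetP[j jI xE]]|].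
      by exists j => //; rewrite !inE jI andbT; apply: contraNneq xNi => <-; rewrite xE.
    move=> [j]; rewrite !inE => /andP[ji jI] ->.
    by rewrite (inj_eq g_inj) ji imset_f.
  rewrite !gf imset_proper //; [exact: in2W|exact: II].
rewrite inE; apply/andP; split; last first.
  apply/forall_inP => _ /imsetP[F FFF ->]; apply: imsetS.
  exact: (forall_inP IF).
apply/andP; split.
  apply/fintype.subsetP => _ /imsetP[F /FFf + ->]; rewrite !inE gf => /andP[FT /eqP ->].
  rewrite eqxx andbT; apply: contraNneq FT => /(congr1 (fun A : {set E} => #|A|)).
  by rewrite card_imset // => FT; rewrite eqEcard finset.subsetT FT leqnn.
apply/forall_inP => _ /imsetP[F FFF ->]; apply/forall_inP => _ /imsetP[G GFF ->].
have /orP[FG|GF] := forall_inP (forall_inP FFc F FFF) G GFF.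
  by rewrite (imsetS _ FG).
by rewrite (imsetS _ GF) orbT.
Qed.

Lemma vertex_perm_aut g : g \in closure_aut ->
  vertex_perm g \in simplicial_aut bergman.
Proof.
move=> gA; have im_inj : injective (fun S : {set _} => vertex_perm g @: S).
  by apply: imset_inj; exact: perm_inj.
have gB : [set vertex_perm g @: (S : {set _}) | S in bergman] = bergman.
  apply/eqP; rewrite eqEcard card_imset // leqnn andbT.
  by apply/fintype.subsetP => _ /imsetP[S SB ->]; apply: vertex_perm_bergman.
rewrite inE; apply/forallP => S; apply/eqP.
by rewrite -[in LHS]gB mem_imset.
Qed.

End Bergman.

(* Main.v *)
(** Write [K'] for the complex [bergman f] without the basis simplices.  Its
    simplices are the [{y_i}_(i in I) U {x_F}_(F in FF)] with [f I <> E], and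
    toggling the vertex [x_(f I)] matches them in pairs.  Removing the sets [I]
    one at a time, by decreasing cardinality, therefore collapses [K'] onto the
    cone of apex [x_(f set0)] formed by the simplices with [I] empty.  Each step
    gives both an explicit deformation of the realization and a cone operator on
    chains, so that [K'] is contractible and acyclic over the integers.

    Acyclicity of [K'] makes restriction to the basis simplices an isomorphism
    from the homology of [bergman f] onto the span of the bases.  Contractibility
    makes the quotient map collapsing [K'] to a point a homotopy equivalence;
    the target is the wedge of the spheres obtained from the basis simplices by
    collapsing their boundaries. *)
From HB Require Import structures.
Require Import Defs.
From mathcomp Require Import all_boot all_order all_fingroup all_algebra.
From mathcomp Require Import zify ring lra generic_quotient ring_quotient.
From mathcomp Require Import all_classical all_reals all_analysis homotopy.

Set Implicit Arguments.
Unset Strict Implicit.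
Unset Printing Implicit Defensive.
Import Order.TTheory GRing.Theory Num.Theory.
Local Open Scope ring_scope.

(** * Simplicial chains *)

(** Bases may have different cardinalities, so homology can sit in several degrees and counting
    dimensions does not identify it. Restriction to the basis simplices chooses no representing
    cycles; this is why it commutes with the automorphisms.

    For the homotopy type, the contraction of [K'] is extended to a flow on the whole realization
    that starts at the identity, keeps [K'] inside itself and is constant on [K'] at time 1. Its
    time-1 map factors through the quotient map and gives the homotopy inverse; the flow and the
    flow it induces on the wedge are the two homotopies. Continuity on the wedge comes from
    compactness of the realization. Contractions are defined on the whole of [R^V] and for all real
    times, so that they compose without subspace topologies.

    If [f set0 = E], the complex is [{emptyset}], its only basis is empty and [K'] is void. Nothing
    can then be collapsed to a cone, and this case is treated apart. *)

Section Acyclic.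
Variable V : finType.
Implicit Types (K L : {set {set V}}) (S T : {set V}) (c : chain V) (i : int).

Let vindex (v : V) := index v (enum V).

Let vindex_inj : injective vindex.
Proof. by move=> v w; apply: (@index_inj _ v (enum V)); rewrite ?mem_enum. Qed.

(** The sign of the face [T] in the boundary of [v |: T]: the exponent is the position at which [v]
    is inserted into the reference ordering of [T]. *)
Definition incidence (v : V) T : int :=
  (-1) ^+ #|[set w in T | (vindex w < vindex v)%N]|.

Lemma incidence_sqr v T : incidence v T * incidence v T = 1.
Proof. by rewrite /incidence -expr2 sqrr_sign. Qed.

Lemma incidence_setU1 v w T : v != w -> v \notin T ->
  incidence w (v |: T) = (-1) ^+ (vindex v < vindex w)%N * incidence w T.
Proof.
move=> vw vT; rewrite /incidence -exprD; congr (_ ^+ _).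
have [lt_vw|le_wv] := boolP (vindex v < vindex w)%N.
  rewrite -(_ : v |: [set u in T | (vindex u < vindex w)%N] =
            [set u in v |: T | (vindex u < vindex w)%N]).
    by rewrite cardsU1 !inE (negPf vT).
  apply/setP => u; rewrite !inE; have [->|] := eqVneq u v => //=.
rewrite add0n; apply: eq_card => u; rewrite !inE.
by have [->|] := eqVneq u v => //=; rewrite (negPf le_wv) (negPf vT).
Qed.

Lemma sign_anticomm v w : v != w ->
  (-1) ^+ (vindex w < vindex v)%N = - (-1) ^+ (vindex v < vindex w)%N :> int.
Proof.
move=> vw; have : vindex v != vindex w.
  by apply: contraNneq vw => /vindex_inj ->.
by rewrite neq_ltn => /orP[lt|lt]; rewrite lt ltnNge (ltnW lt) /= expr1 expr0 ?opprK.
Qed.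

(** Exactly one of [v], [w] precedes the other, so exactly one of the two insertions changes sign.
    This is the sign rule of the cone formula; [incidence_anticomm] is the one behind the vanishing
    of the double boundary. *)
Lemma incidence_swap v w T : v != w -> v \notin T -> w \notin T ->
  incidence v (w |: T) * incidence w (v |: T) = - (incidence w T * incidence v T).
Proof.
move=> vw vT wT; rewrite !incidence_setU1 // 1?eq_sym // (sign_anticomm vw).
by rewrite mulrACA mulNr -expr2 sqrr_sign mulN1r mulrC.
Qed.

Lemma incidence_anticomm v w T : v != w -> v \notin T -> w \notin T ->
  incidence v T * incidence w (v |: T) = - (incidence w T * incidence v (w |: T)).
Proof.
move=> vw vT wT; rewrite !incidence_setU1 // 1?eq_sym // (sign_anticomm vw).
by rewrite mulNr mulrN opprK mulrCA [incidence v T * _]mulrC mulrCA.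
Qed.

Let lt_rank : rel V := relpre vindex ltn.

Let lt_rank_trans : transitive lt_rank.
Proof. by move=> x y z; exact: ltn_trans. Qed.

Let enum_set_sorted S : sorted lt_rank (enum S).
Proof.
rewrite {1}/enum_mem -enumT sorted_filter //.
case E : (enum V) => [//|x0 s]; rewrite -E; apply/(sortedP x0) => k lt_k.
by rewrite /lt_rank /= /vindex !index_uniq ?enum_uniq // ltnW.
Qed.

Let enum_val_lt S (k l : 'I_#|S|) : (k < l)%N -> lt_rank (enum_val k) (enum_val l).
Proof.
move=> lt_kl; rewrite (enum_val_nth (enum_val k) k) (enum_val_nth (enum_val k) l).
have szS (m : 'I_#|S|) : (m : nat) \in [pred n | n < size (enum S)]%N.
  by rewrite inE -cardE.
exact: (sorted_ltn_nth lt_rank_trans _ (enum_set_sorted S)).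
Qed.

(** Skipping a position leaves an increasing enumeration, which is the reference ordering of the
    face; hence no permutation sign. *)
Lemma oriented_face S (j : 'I_#|S|) T :
  oriented (@enum_val _ (mem S) \o lift j) T = (T == S :\ enum_val j)%:R.
Proof.
set u := enum_val j.
pose e := @enum_val _ (mem S) \o lift j.
have e_inj : injective e.
  by move=> k l /enum_val_inj /lift_inj.
have eE : codom e = enum (S :\ u).
  apply: (@irr_sorted_eq _ lt_rank lt_rank_trans) => [x|||x].
  - exact: ltnn.
  - rewrite codomE; apply: (@homo_sorted _ _ _ (relpre val ltn)).
      move=> k l /= lt_kl; apply: enum_val_lt => /=.
      by rewrite /bump; case: leqP; case: leqP; lia.
    by rewrite -sorted_map val_enum_ord iota_ltn_sorted.
  - exact: enum_set_sorted.
  rewrite mem_enum !inE; apply/codomP/andP => [[k ->]|[xu xS]].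
    by rewrite /= enum_valP (inj_eq enum_val_inj) eq_sym neq_lift.
  have [k jk] : {k | enum_rank_in xS x = lift j k}.
    case: (unliftP j (enum_rank_in xS x)) => [k ->|jE]; first by exists k.
    by case/eqP: xu; rewrite /u -jE enum_rankK_in.
  by exists k; rewrite /e /= -jk enum_rankK_in.
rewrite ffunE; have [->|neT] := eqVneq T (S :\ u).
  rewrite (big_pred1 1%g) ?odd_perm1 ?expr0 // => w.
  rewrite -eE; apply/eqP/eqP => [/eq_in_map wE|->]; last first.
    by apply: eq_codom => i /=; rewrite perm1.
  apply/permP => i; apply: e_inj; rewrite perm1; apply: wE.
  by rewrite mem_enum.
rewrite big1 // => w /eqP eT; case/eqP: neT.
apply/setP => x; rewrite -mem_enum -[RHS]mem_enum -eE -eT.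
apply/codomP/codomP => [[i ->]|[i ->]]; first by exists (w i).
by exists ((w^-1)%g i); rewrite /= permKV.
Qed.

Let index_sorted v s : sorted lt_rank s -> v \in s ->
  index v s = count (fun w => lt_rank w v) s.
Proof.
elim: s => //= x s IHs; rewrite (path_sortedE lt_rank_trans) => /andP[/allP xs ss].
rewrite inE; have [-> _|neq_vx /= vs] := eqVneq v x.
  rewrite {1}/lt_rank /= ltnn add0n -[LHS](count_pred0 s); apply/esym/eq_in_count.
  by move=> w /xs lt_xw; apply/negbTE; rewrite -leqNgt ltnW.
by rewrite IHs // xs.
Qed.

Lemma index_enum_set S v : v \in S ->
  index v (enum S) = #|[set w in S | (vindex w < vindex v)%N]|.
Proof.
move=> vS; rewrite index_sorted ?mem_enum // cardE -size_filter.
apply/perm_size/uniq_perm; rewrite ?filter_uniq -?enumT ?enum_uniq //.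
by move=> w; rewrite mem_filter !mem_enum !inE andbC.
Qed.

(** Replaces sums over positions in an ordering by sums over added vertices; the later vanishing and
    cone arguments use the boundary in this form. *)
Lemma boundaryE c T :
  boundary c T = \sum_(v | v \notin T) incidence v T * c (v |: T).
Proof.
rewrite /boundary sum_ffunE.
transitivity (\sum_(S : {set V}) \sum_(v in S)
    (T == S :\ v)%:R * (incidence v (S :\ v) * c S)).
  apply: eq_bigr => S _; rewrite sum_ffunE.
  rewrite [RHS]big_enum_val /=; apply: eq_bigr => j _.
  rewrite chainMzE oriented_face; congr (_ * (_ * _)).
  rewrite /incidence; congr (_ ^+ _).
  rewrite -[LHS](_ : index (enum_val j) (enum S) = j); last first.
    by rewrite (enum_val_nth (enum_val j)) index_uniq ?enum_uniq // -cardE.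
  rewrite index_enum_set ?enum_valP //; apply: eq_card => w; rewrite !inE.
  by have [->|//] := eqVneq w (enum_val j); rewrite ltnn andbF.
rewrite (exchange_big_dep predT) //= [RHS]big_mkcond; apply: eq_bigr => v _.
case: ifPn => [vT|vT].
  rewrite (bigD1 (v |: T)) ?setU11 //= finset.setU1K // eqxx mul1r big1 ?addr0 //.
  move=> S /andP[vS neS]; case: eqP => [TE|]; last by rewrite mul0r.
  by case/eqP: neS; rewrite TE finset.setD1K.
rewrite big1 // => S vS; case: eqP => [TE|]; last by rewrite mul0r.
by move: vT; rewrite TE !inE eqxx.
Qed.

Lemma boundary_boundary c : boundary (boundary c) = 0.
Proof.
apply/ffunP => T; rewrite [RHS]ffunE boundaryE.
pose P (p : V * V) := [&& p.1 \notin T, p.2 \notin T & p.1 != p.2].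
pose F p := incidence p.1 T * incidence p.2 (p.1 |: T) * c (p.2 |: (p.1 |: T)).
have -> : \sum_(v | v \notin T) incidence v T * boundary c (v |: T) =
          \sum_(p | P p) F p.
  rewrite -(pair_big_dep (fun v => v \notin T)
    (fun v w => (w \notin T) && (v != w)) (fun v w => F (v, w))) /=.
  apply: eq_bigr => v vT; rewrite boundaryE mulr_sumr.
  apply: eq_big => [w|w _]; last by rewrite /F /= mulrA.
  by rewrite !inE negb_or andbC eq_sym.
(* Exchanging the two added vertices flips every sign, and an integer equal to its opposite is
   zero. *)
suff : \sum_(p | P p) F p = - \sum_(p | P p) F p by lia.
rewrite -sumrN (reindex_inj (can_inj (@swap_pairK V V))) /=.
apply: eq_big => [[v w]|[v w] /and3P[/= wT vT neq]].
  by rewrite /P /= eq_sym andbCA.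
by rewrite /F /= incidence_anticomm // finset.setUCA mulNr.
Qed.

(** The join with [a]. Simplices of [c] that already contain [a] are dropped, their join being
    degenerate. *)
Definition cone_chain (a : V) c : chain V :=
  [ffun S : {set V} => if a \in S then incidence a (S :\ a) * c (S :\ a) else 0].

Lemma boundary_cone a c : boundary (cone_chain a c) = c - cone_chain a (boundary c).
Proof.
apply/ffunP => T; rewrite boundaryE ffunE [X in _ + X]ffunE [cone_chain _ _ T]ffunE.
case: ifPn => aT; last first.
  rewrite subr0 (bigD1 a) //= ffunE setU11 finset.setU1K // mulrA incidence_sqr mul1r.
  rewrite big1 ?addr0 // => v /andP[vT va].
  by rewrite ffunE !inE eq_sym (negPf va) (negPf aT) mulr0.
set U := T :\ a; have TE : a |: U = T by exact: finset.setD1K.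
have aU : a \notin U by rewrite !inE eqxx.
rewrite (boundaryE c U) [X in _ - _ * X](bigD1 a aU) /= TE mulrDr mulrA incidence_sqr mul1r.
rewrite opprD addrA subrr add0r mulr_sumr -sumrN.
apply: eq_big => [v|v]; first by rewrite -TE !inE negb_or andbC.
rewrite -TE !inE negb_or => /andP[va vU].
rewrite ffunE !inE eqxx orbT.
have -> : (v |: (a |: U)) :\ a = v |: U.
  by rewrite finset.setUCA finset.setU1K // finset.in_setU1 negb_or eq_sym va.
by rewrite !mulrA -mulNr -incidence_swap // !inE.
Qed.

Lemma chainsP K i c :
  reflect (forall S, c S != 0 -> (S \in K) /\ #|S|%:Z - 1 = i) (c \in chains K i).
Proof.
apply: (iffP forallP) => cK S; first by have /implyP/[apply]/andP[? /eqP] := cK S.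
by apply/implyP => /cK[-> ->]; rewrite eqxx.
Qed.

Definition simplicial_complex K := forall S T, T \subset S -> S \in K -> T \in K.

Lemma boundary_chains K i c : simplicial_complex K ->
  c \in chains K i -> boundary c \in chains K (i - 1).
Proof.
move=> Kc /chainsP cK; apply/chainsP => T; rewrite boundaryE => dT.
have [v vT] : exists2 v, v \notin T & c (v |: T) != 0.
  apply: contra_neqP dT => no_v; rewrite big1 // => v vT.
  have [->|cv] := eqVneq (c (v |: T)) 0; first by rewrite mulr0.
  by case: no_v; exists v.
move=> /cK[vK <-]; split; first exact: Kc (finset.subsetUr _ _) vK.
by rewrite cardsU1 vT; lia.
Qed.

Lemma cone_chains K i a c : (forall S, c S != 0 -> a |: S \in K) ->
  c \in chains K i -> cone_chain a c \in chains K (i + 1).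
Proof.
move=> aK /chainsP cK; apply/chainsP => S; rewrite ffunE.
case: ifPn => [aS|]; last by rewrite eqxx.
have [->|cS _] := eqVneq (c (S :\ a)) 0; first by rewrite mulr0 eqxx.
have [_ <-] := cK _ cS; rewrite -{1}(finset.setD1K aS) aK //; split=> //.
by rewrite (cardsD1 a S) aS; lia.
Qed.

(** Reduced homology vanishes in every degree: true of the void complex, false of the complex whose
    only simplex is empty. *)
Definition acyclic K := forall i c, c \in chains K i -> boundary c = 0 ->
  exists2 d, d \in chains K (i + 1) & boundary d = c.

Lemma cone_acyclic K a : (forall S, S \in K -> a |: S \in K) -> acyclic K.
Proof.
move=> aK i c cK dc; exists (cone_chain a c); last first.
  rewrite boundary_cone dc (_ : cone_chain a 0 = 0) ?subr0 //.
  by apply/ffunP => S; rewrite !ffunE mulr0 if_same.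
by apply: cone_chains => // S /(chainsP _ _ _ cK) [/aK].
Qed.

(* The part of a cycle carried by simplices containing [I] is coned off with
   apex [a]; what remains is homologous to it and carried by the subcomplex. *)
Lemma collapse_acyclic K (I : {set V}) a : simplicial_complex K -> a \notin I ->
  (forall S, S \in K -> I \subset S -> a |: S \in K) ->
  acyclic [set S in K | ~~ (I \subset S)] -> acyclic K.
Proof.
move=> Kc aI aK acyL i c cK dc.
pose cI : chain V := [ffun S : {set V} => if I \subset S then c S else 0].
have cIK : cI \in chains K i.
  apply/chainsP => S; rewrite ffunE; case: ifP => _; last by rewrite eqxx.
  exact: (chainsP _ _ _ cK).
have coneK : cone_chain a cI \in chains K (i + 1).
  apply: cone_chains => // S; rewrite ffunE; case: ifPn => [IS|]; last by rewrite eqxx.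
  by move=> /(chainsP _ _ _ cK)[SK _]; apply: aK.
pose r := c - boundary (cone_chain a cI).
have rK : r \in chains K i.
  by rewrite rpredB // -[i](addrK 1); apply: boundary_chains.
(* By the cone formula [r] is [c - cI] plus the cone over [boundary cI]. Above [I] the difference
   vanishes and [boundary cI] agrees with [boundary c = 0]; removing [a] stays above [I] because [a]
   is not in [I]. *)
have rI S : I \subset S -> r S = 0.
  move=> IS; rewrite /r boundary_cone opprB addrCA ffunE.
  rewrite [X in _ + X]ffunE [X in _ + (_ + X)]ffunE.
  rewrite [cI S]ffunE IS subrr addr0 ffunE.
  case: ifPn => // aS.
  have IT : I \subset S :\ a.
    by rewrite finset.subsetD1 IS.
  suff -> : boundary cI (S :\ a) = 0 by rewrite mulr0.
  transitivity (boundary c (S :\ a)); last by rewrite dc ffunE.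
  rewrite !boundaryE; apply: eq_bigr => v _; rewrite ffunE.
  by rewrite (fintype.subset_trans IT) // finset.subsetUr.
have [||d dL dr] := acyL i r.
- apply/chainsP => S rS; have [SK <-] := chainsP _ _ _ rK S rS.
  split=> //; rewrite inE SK; apply: contraNN rS => IS; rewrite rI //.
- by rewrite raddfB /= dc boundary_boundary subr0.
exists (cone_chain a cI + d); last by rewrite raddfD /= dr addrC subrK.
rewrite rpredD //; apply/chainsP => S /(chainsP _ _ _ dL)[].
by rewrite inE => /andP[].
Qed.

End Acyclic.

(** * Homology of a complex that becomes acyclic when some facets are removed *)

Section HomologyFacets.
Local Open Scope quotient_scope.
Variables (V : finType) (K BB : {set {set V}}).
Implicit Types (S T : {set V}) (c : chain V) (i : int).

Definition restrict_chain c : chain V := [ffun S : {set V} => if S \in BB then c S else 0].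

Lemma restrict_zmod : zmod_morphism restrict_chain.
Proof.
move=> c d; apply/ffunP => S; rewrite !ffunE.
by case: ifP => _; rewrite ?ffunE ?subr0 // [X in _ + X]ffunE ?oppr0 ?addr0.
Qed.
HB.instance Definition _ :=
  GRing.isZmodMorphism.Build (chain V) (chain V) restrict_chain restrict_zmod.

Lemma restrict_act (g : {perm V}) c : (forall S, (g @: S \in BB) = (S \in BB)) ->
  restrict_chain (chain_act g c) = chain_act g (restrict_chain c).
Proof.
move=> gBB; apply/ffunP => T; rewrite ffunE !sum_ffunE.
transitivity (\sum_(S : {set V}) if T \in BB then
    (oriented (g \o @enum_val _ (mem S)) *~ c S) T else 0).
  by case: ifP => _ //; rewrite big1.
apply: eq_bigr => S _; rewrite !chainMzE [restrict_chain c S]ffunE.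
have [->|neT] := eqVneq T (g @: S).
  by rewrite gBB; case: ifP => //; rewrite mulr0.
have -> : oriented (g \o @enum_val _ (mem S)) T = 0.
  rewrite ffunE big1 // => w /eqP eT; case/eqP: neT; exact: codom_ref eT.
by rewrite !mul0r if_same.
Qed.

Hypothesis K_complex : simplicial_complex K.
Hypothesis BB_facets : BB \subset facets K.

Lemma facet_max S T : S \in BB -> S \subset T -> T \in K -> T = S.
Proof.
move=> /(fintype.subsetP BB_facets); rewrite inE => /maxsetP[_ maxS] ST TK.
exact: maxS.
Qed.

Lemma facet_simplex S : S \in BB -> S \in K.
Proof. by move=> /(fintype.subsetP BB_facets); rewrite inE => /maxsetP[]. Qed.

Lemma complex_setD_facets : simplicial_complex (K :\: BB).
Proof.
move=> S T TS; rewrite !inE => /andP[SBB SK]; rewrite (K_complex TS SK) andbT.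
by apply: contraNN SBB => TBB; rewrite (facet_max TBB TS SK).
Qed.

(** A facet is a proper face of no simplex, so it never occurs in a boundary. Restriction is
    therefore well defined on homology. *)
Lemma restrict_boundary i c : c \in chains K i -> restrict_chain (boundary c) = 0.
Proof.
move=> /chainsP cK; apply/ffunP => S; rewrite ffunE [RHS]ffunE; case: ifP => // SBB.
rewrite boundaryE big1 // => v vS; have [->|] := eqVneq (c (v |: S)) 0.
  by rewrite mulr0.
move=> /cK[vK _]; case/negP: vS.
by rewrite -(facet_max SBB (finset.subsetUr _ _) vK) setU11.
Qed.

Lemma restrict_chains i c : c \in chains K i -> restrict_chain c \in chains BB i.
Proof.
move=> /chainsP cK; apply/chainsP => S; rewrite ffunE.
by case: ifP => [SBB /cK[]|]; rewrite ?eqxx.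
Qed.

Lemma chains_facets i c : c \in chains BB i ->
  c \in chains K i /\ restrict_chain c = c.
Proof.
move=> /chainsP cBB; split.
  by apply/chainsP => S /cBB[/facet_simplex].
apply/ffunP => S; rewrite ffunE; case: ifPn => // SBB.
by apply/esym; apply: contraNeq SBB => /cBB[].
Qed.

Hypothesis acyclicD : acyclic (K :\: BB).

Definition homology_restrict i (h : homology K i) : chain V :=
  restrict_chain (val (repr h)).

Lemma homology_restrict_pi i (z : Defs.cycle K i) :
  homology_restrict (\pi_(homology K i) z) = restrict_chain (val z).
Proof.
have : repr (\pi_(homology K i) z) - z \in @boundaries _ K i.
  by rewrite Quotient.idealrBE reprK.
move=> /asboolP[d dK /(congr1 restrict_chain)].
by rewrite (restrict_boundary dK) !raddfB /= => /esym/eqP; rewrite subr_eq0 => /eqP.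
Qed.

Lemma homology_restrict_zmod i : zmod_morphism (@homology_restrict i).
Proof.
move=> x y; rewrite -[x]reprK -[y]reprK -raddfB !homology_restrict_pi.
by rewrite !raddfB.
Qed.
HB.instance Definition _ i := GRing.isZmodMorphism.Build (homology K i) (chain V)
  (@homology_restrict i) (@homology_restrict_zmod i).

(** A cycle that vanishes on the removed facets lies in the acyclic complement and bounds there. *)
Lemma homology_restrict_inj i : injective (@homology_restrict i).
Proof.
suff h0 (h : homology K i) : homology_restrict h = 0 -> h = 0.
  exact: raddf_inj h0.
rewrite -[h]reprK homology_restrict_pi.
move: (repr h) => z zBB; have /andP[zK /eqP dz] := Defs.cycleP z.
have zL : val z \in chains (K :\: BB) i.
  apply/chainsP => S zS; have [SK <-] := chainsP _ _ _ zK S zS.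
  rewrite inE SK andbT; split=> //; apply: contraNN zS => SBB.
  by move/ffunP/(_ S): zBB; rewrite !ffunE SBB => ->.
have [d dL dE] := acyclicD zL dz.
have <- : \pi_(homology K i) 0 = 0 by rewrite raddf0.
apply/eqP; rewrite -Quotient.idealrBE subr0; apply/asboolP.
exists d => //; apply/chainsP => S /(chainsP _ _ _ dL)[].
by rewrite inE => /andP[].
Qed.

(** The boundary of a chain [c] on the facets is a cycle of the complement. Filling it there by [d]
    yields the cycle [c - d], whose restriction is still [c]. *)
Lemma homology_restrict_im i c :
  c \in chains BB i <-> exists h, @homology_restrict i h = c.
Proof.
split=> [cBB|[h <-]]; last first.
  by apply: restrict_chains; have /andP[] := Defs.cycleP (repr h).
have [cK cE] := chains_facets cBB.
have dcL : boundary c \in chains (K :\: BB) (i - 1).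
  apply/chainsP => S dS.
  have [SK ?] := chainsP _ _ _ (boundary_chains K_complex cK) S dS.
  split=> //; rewrite inE SK andbT; apply: contraNN dS => SBB.
  by have /ffunP/(_ S) := restrict_boundary cK; rewrite !ffunE SBB => ->.
have [d dL dE] := acyclicD dcL (boundary_boundary c); rewrite subrK in dL.
have dK : d \in chains K i.
  by apply/chainsP => S /(chainsP _ _ _ dL)[]; rewrite inE => /andP[].
have zP : c - d \in cycles K i by rewrite inE rpredB //= raddfB /= dE subrr.
exists (\pi_(homology K i) (Cycle zP)); rewrite homology_restrict_pi /= raddfB /= cE.
rewrite [X in _ - X](_ : _ = 0) ?subr0 //; apply/ffunP => S; rewrite !ffunE.
by case: ifPn => // SBB; apply/eqP; apply: contraTT SBB => /(chainsP _ _ _ dL)[];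
  rewrite inE => /andP[].
Qed.

Theorem homology_facet_chains i :
  exists phi : {additive homology K i -> chain V},
    [/\ injective phi, forall c, c \in chains BB i <-> exists h, phi h = c
      & forall z, phi (\pi_(homology K i) z) = restrict_chain (val z)].
Proof.
exists (@homology_restrict i : {additive homology K i -> chain V}); split.
- exact: homology_restrict_inj.
- exact: homology_restrict_im.
- exact: homology_restrict_pi.
Qed.

End HomologyFacets.

(** The sign may stay unspecified, since only the span of such chains matters later. *)
Lemma oriented_inj (V : finType) n (v : 'I_n -> V) : injective v ->
  exists e : bool, forall T, oriented v T = (-1) ^+ e * (T == [set v k | k in 'I_n])%:R.
Proof.
move=> v_inj; have [S [eS [w vE]]] := oriented_std v_inj; subst n.
exists w => T; rewrite {1}vE.
have -> : @enum_val _ (mem S) \o w \o cast_ord (erefl #|S|) = @enum_val _ (mem S) \o w.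
  by apply/funext => k /=; rewrite cast_ord_id.
rewrite oriented_perm chainMzE oriented_ref ffunE mulrC.
suff -> : [set v k | k in 'I_#|S|] = S by [].
apply/setP => x; apply/imsetP/idP => [[k _ ->]|xS]; first by rewrite vE enum_valP.
exists (w^-1%g (enum_rank_in xS x)) => //.
by rewrite vE /= cast_ord_id permKV enum_rankK_in.
Qed.

(** * Topological preliminaries *)

Section Topology.
Import numFieldNormedType.Exports.
Local Open Scope classical_set_scope.

Lemma continuous_prod (Z : topologicalType) (I : eqType)
    (X : I -> topologicalType) (F : Z -> prod_topology X) :
  (forall i, continuous (fun z => F z i)) -> continuous F.
Proof.
move=> cF z; apply/cvg_sup => i; apply: continuous_comp_initial; exact: cF.
Qed.

Lemma continuous_subtype (Z X : topologicalType) (A : set X) (F : Z -> A) :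
  continuous (fun z => set_val (F z)) -> continuous F.
Proof. exact: continuous_comp_initial. Qed.

Lemma set_val_continuous (X : topologicalType) (A : set X) :
  continuous (@set_val X A).
Proof. exact: initial_continuous. Qed.

Lemma continuous_mx (Z X : topologicalType) m n (F : Z -> 'M[X]_(m, n)) :
  (forall i j, continuous (fun z => F z i j)) -> continuous F.
Proof.
move=> cF z U [P nP PU]; apply: filterS (PU) _.
have cFz i j : \forall y \near z, P i j (F y i j) by apply: cF; exact: nP.
by apply: filter_forall => i; apply: filter_forall => j; exact: cFz.
Qed.

Lemma mx_entry_continuous (X : topologicalType) m n (i : 'I_m) (j : 'I_n) :
  continuous (fun A : 'M[X]_(m, n) => A i j).
Proof.
move=> A U nU; exists (fun k l => if (k == i) && (l == j) then U else setT).
  by move=> k l; case: ifP => [/andP[/eqP-> /eqP->]//|_]; exact: filterT.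
by move=> B /(_ i j); rewrite !eqxx.
Qed.

Lemma hausdorff_separating (X Y : topologicalType) (I : Type) (f : I -> X -> Y) :
  hausdorff_space Y -> (forall i, continuous (f i)) ->
  (forall x y, (forall i, f i x = f i y) -> x = y) -> hausdorff_space X.
Proof.
move=> hY cf sep x y clxy; apply: sep => i; apply: hY => U V /cf nU /cf nV.
by have [z [Uz Vz]] := clxy _ _ nU nV; exists (f i z).
Qed.

Lemma compact_subtype (X : topologicalType) (A : set X) :
  compact A -> compact [set: A].
Proof.
move=> cA F FF _.
have [|x [Ax clx]] := cA (set_val @ F) _.
  by apply: (@filterE _ F) => a; exact: set_valP.
exists (exist _ x (mem_set Ax)); split => // U W FU [_ [[B oB <-] Bx BW]].
have [|_ [[u Uu <-] Bu]] := clx (set_val @` U) B _ (open_nbhs_nbhs (conj oB Bx)).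
  by apply: (@filterS _ F _ U) => // u Uu; exists u.
by exists u; split => //; apply: BW.
Qed.

(* Continuity descends along a quotient map [q], uniformly in a parameter [s];
   compactness of [X] and separation of [W] replace openness of [q]. *)
Lemma continuous_descent (X W T Y : topologicalType) (q : X -> W)
    (h : W * T -> Y) :
  compact [set: X] -> hausdorff_space W -> continuous q ->
  (forall w, exists x, q x = w) ->
  continuous (fun z : X * T => h (q z.1, z.2)) -> continuous h.
Proof.
move=> /compact_near_coveringP cX; rewrite open_hausdorff => hW cq q_surj ch [w s] U nU.
(* Compactness makes this implication uniform in [x]. Near a point over [w] it is continuity of [h]
   composed with [q]; near any other point separation makes its premise false. *)
have : \forall z \near (w, s), [set: X] `<=` (fun x => q x = z.1 -> U (h z)).
  apply: (cX _ (nbhs ((w, s) : W * T)) (fun z x => q x = z.1 -> U (h z))) => x _.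
  have [qxw|qxw] := pselect (q x = w).
    have [[P Q] /= [Px Qs] PQ] := ch (x, s) U (ltac:(by rewrite /= qxw)).
    exists (P, setT `*` Q).
      split => //=; exists (setT, Q) => //; split => //; exact: filterT.
    move=> [x' [w' s']] /= [Px' [_ Qs']] qx'.
    by have := PQ (x', s') (conj Px' Qs'); rewrite /= qx'.
  have [[A B] /= [Ax Bw] [oA oB /eqP AB]] := hW _ _ (introN eqP qxw).
  exists (q @^-1` A, B `*` setT).
    split => /=.
      by apply: cq; apply: open_nbhs_nbhs; split => //; exact: set_mem.
    exists (B, setT) => //; split; last exact: filterT.
    by apply: open_nbhs_nbhs; split => //; exact: set_mem.
  move=> [x' [w' s']] /= [Ax' [Bw' _]] qx'.
  suff : set0 w' by [].
  by rewrite -AB; split => //; rewrite -qx'.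
by apply: filterS => z Pz; have [x qx] := q_surj z.1; exact: Pz x I qx.
Qed.

Lemma pair_continuous (Z X Y : topologicalType) (f : Z -> X) (g : Z -> Y) :
  continuous f -> continuous g -> continuous (fun z => (f z, g z)).
Proof. by move=> cf cg z; apply: cvg_pair; [exact: cf|exact: cg]. Qed.

Lemma cts_comp (X Y Z : topologicalType) (f : X -> Y) (g : Y -> Z) :
  continuous f -> continuous g -> continuous (fun x => g (f x)).
Proof. by move=> cf cg x; apply: continuous_comp; [exact: cf|exact: cg]. Qed.

Lemma eq_continuous (X Y : topologicalType) (f g : X -> Y) :
  f =1 g -> continuous f -> continuous g.
Proof. by move=> /funext ->. Qed.

Lemma fst_continuous (X Y : topologicalType) : continuous (fun z : X * Y => z.1).
Proof. by move=> z; exact: cvg_fst. Qed.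

Lemma snd_continuous (X Y : topologicalType) : continuous (fun z : X * Y => z.2).
Proof. by move=> z; exact: cvg_snd. Qed.

Section RealContinuity.
Variables (R : realType) (Z : topologicalType).
Implicit Types f g : Z -> R.

Lemma ctsC (c : R) : continuous (fun _ : Z => c).
Proof. by move=> z; exact: cvg_cst. Qed.

Lemma ctsD f g : continuous f -> continuous g -> continuous (fun z => f z + g z).
Proof. by move=> cf cg z; apply: cvgD; [exact: cf|exact: cg]. Qed.

Lemma ctsB f g : continuous f -> continuous g -> continuous (fun z => f z - g z).
Proof. by move=> cf cg z; apply: cvgB; [exact: cf|exact: cg]. Qed.

Lemma ctsM f g : continuous f -> continuous g -> continuous (fun z => f z * g z).
Proof. by move=> cf cg z; apply: cvgM; [exact: cf|exact: cg]. Qed.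

Lemma ctsV f : (forall z, f z != 0) -> continuous f -> continuous (fun z => (f z)^-1).
Proof. by move=> f0 cf z; apply: cvgV; [exact: f0|exact: cf]. Qed.

Lemma cts_min f g : continuous f -> continuous g ->
  continuous (fun z => Num.min (f z) (g z)).
Proof. by move=> cf cg z; apply: continuous_min; [exact: cf|exact: cg]. Qed.

Lemma cts_max f g : continuous f -> continuous g ->
  continuous (fun z => Num.max (f z) (g z)).
Proof. by move=> cf cg z; apply: continuous_max; [exact: cf|exact: cg]. Qed.

Lemma cts_big (op : R -> R -> R) (x0 : R) (I : Type) (r : seq I) (P : pred I)
    (F : I -> Z -> R) :
  (forall f g, continuous f -> continuous g -> continuous (fun z => op (f z) (g z))) ->
  (forall i, P i -> continuous (F i)) ->
  continuous (fun z => \big[op/x0]_(i <- r | P i) F i z).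
Proof.
move=> cop cF; elim: r => [|i r IHr].
  apply: (eq_continuous _ (@ctsC x0)) => z; by rewrite big_nil.
have [Pi|Pi] := boolP (P i).
  apply: (eq_continuous _ (cop _ _ (cF i Pi) IHr)) => z.
  by rewrite big_cons Pi.
by apply: (eq_continuous _ IHr) => z; rewrite big_cons (negPf Pi).
Qed.

Lemma cts_sum (I : Type) (r : seq I) (P : pred I) (F : I -> Z -> R) :
  (forall i, P i -> continuous (F i)) ->
  continuous (fun z => \sum_(i <- r | P i) F i z).
Proof. by apply: cts_big; exact: ctsD. Qed.

Lemma cts_bigmin (I : Type) (r : seq I) (P : pred I) x0 (F : I -> Z -> R) :
  (forall i, P i -> continuous (F i)) ->
  continuous (fun z => \big[Num.min/x0]_(i <- r | P i) F i z).
Proof. by apply: cts_big; exact: cts_min. Qed.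

End RealContinuity.

Definition clamp (R : realType) (s : R) : R := Num.max 0 (Num.min 1 s).

Lemma clamp_itv (R : realType) (s : R) : 0 <= clamp s <= 1.
Proof. by rewrite /clamp le_max lexx /= ge_max ler01 ge_min lexx. Qed.

Lemma clamp_id (R : realType) (s : R) : 0 <= s <= 1 -> clamp s = s.
Proof. by move=> /andP[s0 s1]; rewrite /clamp min_r // max_r. Qed.

Lemma clamp_le0 (R : realType) (s : R) : s <= 0 -> clamp s = 0.
Proof.
by move=> s0; rewrite /clamp max_l // ge_min s0 orbT.
Qed.

Lemma clamp_ge1 (R : realType) (s : R) : 1 <= s -> clamp s = 1.
Proof. by move=> s1; rewrite /clamp min_l // max_r. Qed.

Lemma cts_clamp (R : realType) (Z : topologicalType) (f : Z -> R) :
  continuous f -> continuous (fun z => clamp (f z)).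
Proof.
by move=> cf; apply: cts_max; [exact: ctsC|apply: cts_min => //; exact: ctsC].
Qed.

(** Time is reversed because the flows built below start at the identity, while
    [homotopy_equivalent] asks for homotopies that end there. *)
Lemma homotopic_of_continuous (R : realType) (X Y : topologicalType) (f g : X -> Y)
    (H : X * R -> Y) : continuous H -> (forall x, H (x, 1) = f x) ->
  (forall x, H (x, 0) = g x) -> homotopic R f g.
Proof.
move=> cH H1 H0; exists (fun z => H (z.1, 1 - z.2)); split=> [|x|x].
- apply: continuous_subspaceT; apply: (@cts_comp _ _ _ _ H) => //.
  apply: pair_continuous; first exact: fst_continuous.
  by apply: ctsB; [exact: ctsC|exact: snd_continuous].
- by rewrite /= subr0.
- by rewrite /= subrr.
Qed.

(** * Points of a realization *)

Section Points.
Variables (R : realType) (V : finType).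
Implicit Types (K L : {set {set V}}) (S A : {set V}) (a v : V) (s : R).
Implicit Types t : {ptws V -> R}.

Definition points K : set {ptws V -> R} :=
  [set t | [/\ forall v, 0 <= t v, \sum_v t v = 1 & [set v | t v != 0]%SET \in K]].

Lemma points_realization K (x : realization R K) : points K (set_val x).
Proof. exact: set_valP. Qed.

Lemma points_le1 K t v : points K t -> t v <= 1.
Proof.
move=> [t0 t1 _]; rewrite -t1 (bigD1 v) //= lerDl; exact: sumr_ge0.
Qed.

Lemma sub_points K L t : (forall S, S \in K -> S \in L) -> points K t -> points L t.
Proof. by move=> KL [t0 t1 /KL tL]; split. Qed.

(** Positive exactly on the open star of [A]. The default 1 does not affect the minimum over a
    nonempty [A], as coordinates of points are at most 1. *)
Definition low A t : R := \big[Num.min/1]_(v in A) t v.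

Lemma low_ge0 K A t : points K t -> 0 <= low A t.
Proof. by move=> [t0 _ _]; apply/bigmin_geP; split. Qed.

Lemma low_le A t v : v \in A -> low A t <= t v.
Proof. exact: bigmin_le_cond. Qed.

Lemma low_gt0 K A t : points K t ->
  (0 < low A t) = (A \subset [set v | t v != 0]%SET).
Proof.
move=> [t0 _ _]; apply/bigmin_gtP/fintype.subsetP => [[_ tA] v vA|tA].
  by rewrite inE gt_eqF // tA.
by split=> // v /tA; rewrite inE lt_def t0 andbT.
Qed.

Lemma low_attained K A t : points K t -> A != finset.set0 ->
  exists2 v, v \in A & low A t = t v.
Proof.
move=> tK /set0Pn[v vA]; rewrite /low.
have [w wA ->] := @eq_bigmin _ _ _ 1 v (fun w => w \in A) t vA (fun w _ => points_le1 w tK).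
by exists w.
Qed.

Lemma cts_eval v : continuous (fun t : {ptws V -> R} => t v).
Proof. exact: (@proj_continuous _ (fun=> R) v). Qed.

Lemma cts_low (Z : topologicalType) A (F : Z -> {ptws V -> R}) :
  continuous F -> continuous (fun z => low A (F z)).
Proof.
move=> cF; apply: cts_bigmin => v _.
exact: (cts_comp cF (@cts_eval v)).
Qed.

(** [C] is continuous on the whole ambient space, so a contraction of a subcomplex can be composed
    with a deformation of a larger complex. *)
Definition ptcontractible K := exists (C : {ptws V -> R} * R -> {ptws V -> R}) t0,
  [/\ continuous C, points K t0, forall t, C (t, 0) = t,
      forall t, points K t -> C (t, 1) = t0
    & forall t s, points K t -> 0 <= s <= 1 -> points K (C (t, s))].

Lemma sum_indicator a : \sum_v (v == a)%:R = 1 :> R.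
Proof. by rewrite (bigD1 a) //= eqxx big1 ?addr0 // => v va; rewrite (negPf va). Qed.

Lemma sum_indicator_set A : \sum_v (v \in A)%:R = #|A|%:R :> R.
Proof.
by rewrite -natr_sum -sum1_card [in RHS]big_mkcond; congr _%:R; apply: eq_bigr.
Qed.

Lemma cone_contractible K a : simplicial_complex K -> K != finset.set0 ->
  (forall S, S \in K -> a |: S \in K) -> ptcontractible K.
Proof.
move=> Kc /set0Pn[S0 S0K] aK.
pose t0 : {ptws V -> R} := fun v => (v == a)%:R.
have sum_t0 : \sum_v t0 v = 1.
  exact: sum_indicator.
exists (fun z v => (1 - z.2) * z.1 v + z.2 * t0 v), t0; split.
- apply: continuous_prod => v; apply: ctsD; apply: ctsM.
  + by apply: ctsB; [exact: ctsC|exact: snd_continuous].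
  + exact: (cts_comp (@fst_continuous _ _) (@cts_eval v)).
  + exact: snd_continuous.
  + exact: ctsC.
- split=> [v||]; rewrite ?ler0n //; apply: (Kc (a |: S0)); last exact: aK.
  by apply/fintype.subsetP => v; rewrite !inE /t0; have [//|va] := eqVneq v a; rewrite eqxx.
- by move=> t; apply/funext => v /=; rewrite subr0 mul1r mul0r addr0.
- by move=> t _; apply/funext => v /=; rewrite subrr mul0r mul1r add0r.
- move=> t s [t_ge0 t1 tK] /andP[s0 s1]; split => /= [v||].
  + by rewrite addr_ge0 ?mulr_ge0 ?subr_ge0 ?ler0n.
  + by rewrite big_split /= -!mulr_sumr t1 sum_t0 !mulr1 subrK.
  + apply: Kc (aK _ tK); apply/fintype.subsetP => v; rewrite !inE /t0.
    have [//|va] := eqVneq v a.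
    by apply: contraNneq => ->; rewrite !mulr0 addr0.
Qed.

Lemma collapse_contractible K A a : simplicial_complex K -> A != finset.set0 -> a \notin A ->
  (forall S, S \in K -> A \subset S -> a |: S \in K) ->
  ptcontractible [set S in K | ~~ (A \subset S)] -> ptcontractible K.
Proof.
move=> Kc A0 aA aK [C [t0 [cC t0L C0 C1 CL]]].
set L := [set S in K | _] in t0L C1 CL.
have LK t : points L t -> points K t.
  by apply: sub_points => S; rewrite inE => /andP[].
(* All coordinates in [A] drop at the same rate and [a] receives what they lose. At time 1 the least
   of them is zero, so the point has left the open star of [A]; points outside that star do not
   move. *)
pose r (z : {ptws V -> R} * R) : {ptws V -> R} :=
  fun v => z.1 v + z.2 * low A z.1 * (#|A|%:R * (v == a)%:R - (v \in A)%:R).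
have cr : continuous r.
  have cfst := @fst_continuous {ptws V -> R} R.
  apply: continuous_prod => v; apply: ctsD.
    exact: (cts_comp cfst (@cts_eval v)).
  apply: ctsM; last exact: ctsC.
  by apply: ctsM; [exact: snd_continuous|exact: cts_low].
have sum_r t s : \sum_v r (t, s) v = \sum_v t v.
  rewrite /r big_split /= -mulr_sumr big_split /= -mulr_sumr sumrN.
  rewrite sum_indicator mulr1 sum_indicator_set.
  by rewrite subrr mulr0 addr0.
have r_id t s : s * low A t = 0 -> r (t, s) = t.
  by move=> slow; apply/funext => v; rewrite /r /= slow mul0r addr0.
have rK t s : points K t -> 0 <= s <= 1 -> points K (r (t, s)).
  move=> tK /andP[s0 s1]; have lowA := low_ge0 A tK.
  have [low0|low_neq0] := eqVneq (low A t) 0; first by rewrite r_id ?low0 ?mulr0.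
  have At : A \subset [set v | t v != 0]%SET.
    by rewrite -(low_gt0 A tK) lt_def low_neq0.
  have [t_ge0 t1 tK'] := tK; split=> [v||]; last 1 first.
  - apply: (Kc (a |: [set v | t v != 0]%SET)); last exact: aK.
    apply/fintype.subsetP => v; rewrite !inE /r /=; have [//|va] := eqVneq v a.
    apply: contraNneq => tv0; rewrite tv0 add0r mulr0 sub0r.
    by case: (boolP (v \in A)) => [/(fintype.subsetP At)|];
      rewrite ?inE ?tv0 ?eqxx ?oppr0 ?mulr0.
  - rewrite /r /=; have [->|va] := eqVneq v a.
      by rewrite (negPf aA) subr0 mulr1 addr_ge0 ?mulr_ge0 ?ler0n.
    rewrite mulr0 sub0r mulrN subr_ge0; case: (boolP (v \in A)) => vA; last first.
      by rewrite mulr0.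
    rewrite mulr1; apply: le_trans (low_le t vA).
    by rewrite ler_piMl.
  - by rewrite sum_r.
have rL t : points K t -> points L (r (t, 1)).
  move=> tK; have [r_ge0 r1 rtK] := rK t 1 tK (ltac:(by rewrite ler01 lexx)).
  split=> //; rewrite inE rtK /=.
  have [v vA lowv] := low_attained tK A0.
  apply/negP => /fintype.subsetP/(_ v vA); rewrite inE /r /= vA.
  have -> : (v == a) = false by apply: contraNF aA => /eqP <-.
  by rewrite mulr0 sub0r mul1r mulrN1 lowv subrr eqxx.
(* The deformation [r] runs up to time 1/2, then [C]; the clamps freeze each one while the other
   runs. *)
exists (fun z => C (r (z.1, clamp (2 * z.2)), clamp (2 * z.2 - 1))), t0.
have half s : 0 <= s <= 1 -> {s <= 2^-1} + {2^-1 <= s}.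
  by move=> _; case: (lerP s 2^-1) => [|/ltW]; [left|right].
split=> [||t|t tK|t s tK s01].
- apply: (cts_comp _ cC); have c2 : continuous (fun z : {ptws V -> R} * R => 2 * z.2).
    by apply: ctsM; [exact: ctsC|exact: snd_continuous].
  apply: pair_continuous.
    apply: (cts_comp _ cr); apply: pair_continuous.
      exact: fst_continuous.
    exact: cts_clamp.
  by apply: cts_clamp; apply: ctsB => //; exact: ctsC.
- exact: LK.
- rewrite /= mulr0 sub0r [X in r (_, X)]clamp_le0 // [X in C (_, X)]clamp_le0.
    by rewrite C0 r_id // mul0r.
  by rewrite oppr_le0.
- rewrite /= mulr1 (_ : 2 - 1 = 1 :> R); last by rewrite -[2]/(1 + 1) addrK.
  by rewrite !clamp_ge1 ?ler1n // C1 //; exact: rL.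
- rewrite /=; have [s_le|s_ge] := half s s01.
    rewrite [X in C (_, X)]clamp_le0 ?C0; first exact: rK (clamp_itv _).
    by rewrite subr_le0 -ler_pdivlMl // mulr1.
  apply: LK; rewrite [X in r (_, X)]clamp_ge1; last first.
    by rewrite -ler_pdivrMl // mulr1.
  by apply: CL (clamp_itv _); exact: rL.
Qed.

Definition realize K t (tK : points K t) : realization R K :=
  exist _ t (mem_set tK).

Lemma ptcontractibleW K : ptcontractible K -> contractible_complex R K.
Proof.
move=> [C [t0 [cC t0K C0 C1 CK]]]; right; exists (realize t0K).
pose P (z : realization R K * R) :=
  CK _ _ (points_realization z.1) (clamp_itv z.2).
apply: (@homotopic_of_continuous _ _ _ _ _ (fun z => realize (P (z.1, 1 - z.2)))).
- apply: continuous_subtype => /=; apply: (cts_comp _ cC).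
  apply: pair_continuous.
    exact: (cts_comp (@fst_continuous _ _) (@set_val_continuous _ _)).
  by apply: cts_clamp; apply: ctsB; [exact: ctsC|exact: snd_continuous].
- by move=> x; apply/val_inj; rewrite /= subrr clamp_le0 // C0.
- by move=> x; apply/val_inj; rewrite /= subr0 clamp_ge1 // C1 //; exact: points_realization.
Qed.

(** Closure under subsets turns the condition on the support into a finite union of closed ones:
    vanishing outside some simplex. *)
Lemma compact_realization K : simplicial_complex K -> compact [set: realization R K].
Proof.
move=> Kc; apply: compact_subtype.
pose cube := [set t : {ptws V -> R} | forall v, `[0, 1]%classic (t v)].
have ccube : compact cube.
  by apply: (@tychonoff V (fun=> R) (fun=> `[0, 1]%classic)) => v; exact: segment_compact.
apply: (subclosed_compact _ ccube); last first.
  move=> t tK v; rewrite /= in_itv /= (points_le1 v tK) andbT.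
  by have [] := tK.
rewrite (_ : [set _ | _] = (\bigcap_(v in [set: V]) [set t : {ptws V -> R} | 0 <= t v]) `&`
   [set t : {ptws V -> R} | \sum_v t v = 1] `&`
   \bigcup_(S in [set` K]) \bigcap_(v in [set` ~: S])
     [set t : {ptws V -> R} | t v = 0]); last first.
  apply/seteqP; split=> [t [t0 t1 tK]|t [[t0 t1] [S SK tS]]].
    split; first by split => // v _; exact: t0.
    exists [set v | t v != 0]%SET => // v /=.
    by rewrite !inE negbK => /eqP.
  split=> [v||] //; first exact: t0.
  apply: Kc SK; apply/fintype.subsetP => v; rewrite inE; apply: contraNT => vS.
  by apply/eqP/tS; rewrite /= inE.
have ceval v := @cts_eval v.
apply: closedI; first apply: closedI.
- apply: closed_bigI => v _.
  apply: (@preimage_closed {ptws V -> R} R (fun t => t v) [set x | 0 <= x]) => //.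
- apply: (@preimage_closed {ptws V -> R} R (fun t => \sum_v t v) [set 1]) => [t _|].
    by apply: cts_sum => v _; exact: ceval.
  exact: closed_eq.
- apply: closed_bigcup; first exact: finite_finset.
  move=> S _; apply: closed_bigI => v _.
  apply: (@preimage_closed {ptws V -> R} R (fun t => t v) [set 0]) => [t _|].
    exact: ceval.
  exact: closed_eq.
Qed.

End Points.

(** * Collapsing the boundary of a simplex to a point of the sphere *)

Section SphereCollapse.
Variables (R : realType) (n : nat) (p : 'I_n -> R) (k0 : 'I_n).
Hypothesis p_norm : \sum_k p k ^+ 2 = 1.
Hypothesis pk0 : p k0 != 0.
Implicit Types (x t : 'I_n -> R) (m : R) (k : 'I_n).

(* A linear isomorphism carrying the linear form [\sum_k x k] to [<_, p>]. *)
Definition shear x k : R :=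
  if k == k0 then (\sum_l x l - \sum_(l | l != k0) x l * p l) / p k0 else x k.

Lemma shear_dot x : \sum_k shear x k * p k = \sum_k x k.
Proof.
rewrite (bigD1 k0) //= {1}/shear eqxx mulfVK //.
rewrite [X in _ + X](eq_bigr (fun l => x l * p l)) ?subrK // => l lk0.
by rewrite /shear (negPf lk0).
Qed.

Lemma shearZ a x k : shear (fun l => a * x l) k = a * shear x k.
Proof.
rewrite /shear; case: eqP => // _.
have -> : \sum_(l | l != k0) a * x l * p l = a * \sum_(l | l != k0) x l * p l.
  by rewrite mulr_sumr; apply: eq_bigr => l _; rewrite mulrA.
by rewrite -mulr_sumr -mulrBr mulrA.
Qed.

Lemma shear_inj x y : shear x =1 shear y -> x =1 y.
Proof.
move=> xy; have xyN k : k != k0 -> x k = y k.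
  by move=> kk0; have := xy k; rewrite /shear (negPf kk0).
have : \sum_k x k = \sum_k y k.
  by rewrite -(shear_dot x) -(shear_dot y); apply: eq_bigr => k _; rewrite xy.
rewrite (bigD1 k0) // [RHS](bigD1 k0) //= [X in _ + X = _](eq_bigr y) //.
by move=> /addIr xyk0 k; have [->|] := eqVneq k k0; last exact: xyN.
Qed.

Lemma shear_surj y : exists x, shear x =1 y.
Proof.
pose x k := if k == k0 then \sum_l y l * p l - \sum_(l | l != k0) y l else y k.
exists x => k; rewrite /shear; have [->|kk0] := eqVneq k k0; last first.
  by rewrite /x (negPf kk0).
have eqx F : \sum_(l | l != k0) x l * F l = \sum_(l | l != k0) y l * F l.
  by apply: eq_bigr => l lk0; rewrite /x (negPf lk0).
have -> : \sum_l x l = \sum_l y l * p l.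
  rewrite (bigD1 k0) //= {1}/x eqxx.
  rewrite [X in _ + X](eq_bigr y) ?subrK // => l lk0; by rewrite /x (negPf lk0).
by rewrite eqx [in X in X - _](bigD1 k0) //= addrK mulfK.
Qed.

(** The shift makes the coordinates sum to [m] when those of [t] sum to 1, so that the inner product
    with [p] is [m]. *)
Definition direction m t k : R := shear (fun l => t l - (1 - m) / n%:R) k.

(* Reflection of [p] along [direction m t]; for [m] the least coordinate of a
   point [t] of the standard simplex it collapses the boundary [m = 0] to [p]. *)
Definition collapse m t k : R :=
  p k - 2 * m / (\sum_l direction m t l ^+ 2) * direction m t k.

Let n_neq0 : n%:R != 0 :> R.
Proof. by rewrite pnatr_eq0 -lt0n (leq_ltn_trans _ (ltn_ord k0)). Qed.

Lemma direction_dot m t : \sum_k t k = 1 -> \sum_k direction m t k * p k = m.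
Proof.
move=> t1; rewrite shear_dot big_split /= t1 sumr_const card_ord.
by rewrite mulNrn -[X in _ - X]mulr_natr divfK // opprB addrC subrK.
Qed.

Lemma collapse0 t : collapse 0 t = p.
Proof. by apply/funext => k; rewrite /collapse mulr0 !mul0r subr0. Qed.

(** Keeps [collapse] continuous up to the boundary: for [m = 0] a zero coordinate is shifted to
    [- 1 / n]. That alternative also serves points of other simplices, whose coordinates on the
    facet need not sum to 1. *)
Lemma direction_neq0 m t : m = 0 /\ (exists k, t k = 0) \/ m != 0 /\ \sum_k t k = 1 ->
  \sum_l direction m t l ^+ 2 != 0.
Proof.
move=> mt; apply/negP; rewrite psumr_eq0 => [|l _]; last exact: sqr_ge0.
move=> /allP d0; have {}d0 k : direction m t k = 0.
  by have := d0 k (mem_index_enum k); rewrite sqrf_eq0 => /eqP.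
case: mt => [[m0 [k tk]]|[m_neq0 /(direction_dot m)]]; last first.
  by rewrite big1 => [/esym/eqP|k _]; [rewrite (negPf m_neq0)|rewrite d0 mul0r].
have /(_ k) : (fun l => t l - (1 - m) / n%:R) =1 (fun=> 0).
  apply: shear_inj => l; rewrite -[LHS]/(direction m t l) d0.
  have := shearZ 0 (fun=> 0) l; rewrite [RHS]mul0r => shear0; rewrite -[LHS]shear0.
  by congr shear; apply/funext => j; rewrite mul0r.
by rewrite tk m0 subr0 sub0r mul1r => /eqP; rewrite oppr_eq0 invr_eq0 (negPf n_neq0).
Qed.

Lemma collapse_norm m t : m = 0 \/ \sum_k t k = 1 -> \sum_k collapse m t k ^+ 2 = 1.
Proof.
case=> [->|t1]; first by rewrite collapse0.
set D := \sum_l direction m t l ^+ 2.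
have -> : \sum_k collapse m t k ^+ 2 =
    \sum_k (p k ^+ 2 + (- (2 * (2 * m / D)) * (direction m t k * p k)
             + (2 * m / D) ^+ 2 * direction m t k ^+ 2)).
  by apply: eq_bigr => k _; rewrite /collapse -/D; ring.
rewrite !big_split /= -!mulr_sumr p_norm direction_dot // -/D.
have [->|D0] := eqVneq D 0; first by rewrite invr0; ring.
by field.
Qed.

Lemma collapse_dot m t : \sum_k t k = 1 ->
  \sum_k (p k - collapse m t k) * p k = 2 * m / (\sum_l direction m t l ^+ 2) * m.
Proof.
move=> t1; rewrite -[X in _ * X](direction_dot m t1) mulr_sumr.
by apply: eq_bigr => k _; rewrite /collapse opprB addrCA subrr addr0 mulrA.
Qed.

Lemma collapse_neq m t : 0 < m -> \sum_k t k = 1 -> collapse m t <> p.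
Proof.
move=> m0 t1 zp; have := collapse_dot m t1.
rewrite zp big1 => [/esym/eqP|k _]; last by rewrite subrr mul0r.
have D0 : \sum_l direction m t l ^+ 2 != 0.
  by apply: direction_neq0; right; rewrite gt_eqF.
by rewrite !mulf_eq0 invr_eq0 pnatr_eq0 (negPf D0) (gt_eqF m0).
Qed.

Lemma collapse_inj m m' t t' : 0 < m -> 0 < m' ->
  \sum_k t k = 1 -> \sum_k t' k = 1 ->
  (forall k, m <= t k) -> (exists k, t k = m) ->
  (forall k, m' <= t' k) -> (exists k, t' k = m') ->
  collapse m t = collapse m' t' -> t = t'.
Proof.
move=> m0 m'0 t1 t'1 mt [k mk] mt' [k' mk'] zz.
have D0 : \sum_l direction m t l ^+ 2 != 0.
  by apply: direction_neq0; right; rewrite gt_eqF.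
have D'0 : \sum_l direction m' t' l ^+ 2 != 0.
  by apply: direction_neq0; right; rewrite gt_eqF.
have := collapse_dot m' t'1; rewrite -zz collapse_dot //.
have : forall l, p l - collapse m t l = p l - collapse m' t' l by rewrite zz.
rewrite /collapse; move: D0 D'0.
set D := \sum_l _; set D' := \sum_l _ => D0 D'0 dd eD.
have : 2 * m' / D' != 0 by rewrite mulf_neq0 ?invr_eq0 // mulf_neq0 ?pnatr_eq0 // gt_eqF.
move: (2 * m / D) (2 * m' / D') dd eD => c c' dd eD c'0.
(* Both directions are proportional to [p] minus the common image; pairing with [p] shows that their
   ratio is [m : m']. *)
have {dd} xx' : (fun l => m' * (t l - (1 - m) / n%:R)) =1
    (fun l => m * (t' l - (1 - m') / n%:R)).
  apply: shear_inj => l; rewrite !shearZ -/(direction m t l) -/(direction m' t' l).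
  have := dd l; rewrite !subKr => ddl; apply: (mulfI c'0).
  by rewrite [RHS]mulrCA -ddl mulrA -eD; ring.
have nV : 0 < n%:R^-1 :> R by rewrite invr_gt0 lt_def n_neq0 ler0n.
(* At a least coordinate of [t] the proportionality gives [m' <= m], and at one of [t'] the
   converse. *)
have mm' : m = m'.
  have e1 := xx' k; have e2 := xx' k'; rewrite mk in e1; rewrite mk' in e2.
  apply/le_anti/andP; split; rewrite -subr_ge0 -(pmulr_rge0 _ nV).
    have -> : n%:R^-1 * (m' - m) = m' * (t k' - m) by move: e2; lra.
    by rewrite mulr_ge0 ?subr_ge0 ?mt // ltW.
  have -> : n%:R^-1 * (m - m') = m * (t' k - m') by move: e1; lra.
  by rewrite mulr_ge0 ?subr_ge0 ?mt' // ltW.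
apply/funext => l; have := xx' l; rewrite -mm' => /(mulfI (lt0r_neq0 m0)).
exact: addIr.
Qed.

Lemma collapse_surj z : \sum_k z k ^+ 2 = 1 -> z <> p ->
  exists m t, [/\ 0 < m, \sum_k t k = 1, forall k, m <= t k, exists k, t k = m
               & collapse m t = z].
Proof.
move=> z1 zp; pose c := \sum_k (p k - z k) * p k.
have cE : \sum_k (p k - z k) ^+ 2 = 2 * c.
  transitivity (\sum_k (2 * ((p k - z k) * p k) + (z k ^+ 2 - p k ^+ 2))).
    by apply: eq_bigr => k _; ring.
  by rewrite !big_split /= sumrN z1 p_norm subrr addr0 -mulr_sumr.
have c_gt0 : 0 < c.
  rewrite -(pmulr_rgt0 _ (ltr0Sn R 1)) -cE lt_def sumr_ge0 => [|k _]; last exact: sqr_ge0.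
  rewrite andbT psumr_eq0 => [|k _]; last exact: sqr_ge0.
  apply: contra_notN zp => /allP zp; apply/funext => k.
  by have := zp k (mem_index_enum k); rewrite sqrf_eq0 subr_eq0 => /eqP ->.
(* The direction must be a multiple of [p - z]; dividing by [c] makes its inner product with [p]
   equal to 1. *)
have [y yE] := shear_surj (fun k => (p k - z k) / c).
have y1 : \sum_k y k = 1.
  rewrite -shear_dot; under eq_bigr do rewrite yE mulrAC.
  by rewrite -mulr_suml divff // gt_eqF.
pose k1 := [arg min_(k < k0) y k]%O.
have yk1 k : y k1 <= y k by rewrite /k1; case: arg_minP => //= i _; apply.
set mu := y k1 in yk1.
have mu_le : n%:R * mu <= 1.
  have : \sum_(k < n) mu <= \sum_k y k by apply: ler_sum => k _.
  by rewrite y1 sumr_const card_ord -[mu *+ n]mulr_natl.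
have n_ge1 : 1 <= n%:R :> R by rewrite ler1n (leq_ltn_trans _ (ltn_ord k0)).
have den_gt0 : 0 < n%:R * (1 - mu) + 1 by nra.
(* The requirement [direction m t = m * (p - z) / c] forces [t = m * y + (1 - m) / n]. This [m]
   solves the equation that the least coordinate of that vector be [m], and [t] below is the same
   vector rewritten. *)
pose m := (n%:R * (1 - mu) + 1)^-1.
have m_gt0 : 0 < m by rewrite invr_gt0.
pose t k := m * (y k - mu + 1).
have t1 : \sum_k t k = 1.
  rewrite -mulr_sumr 2!big_split /= y1 !sumr_const card_ord -[(- mu) *+ n]mulr_natl.
  by rewrite /m; field; rewrite gt_eqF.
have dirE k : direction m t k = m * ((p k - z k) / c).
  rewrite -yE -shearZ /direction; congr shear; apply/funext => l.
  by rewrite /t /m; field; rewrite n_neq0 gt_eqF.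
exists m, t; split=> // [k||].
- by apply: ler_peMr; rewrite ?(ltW m_gt0) // lerDr subr_ge0.
- by exists k1; rewrite /t subrr add0r mulr1.
apply/funext => k; rewrite /collapse.
have -> : \sum_l direction m t l ^+ 2 = (m / c) ^+ 2 * (2 * c).
  rewrite -cE mulr_sumr; apply: eq_bigr => l _; rewrite dirE.
  by ring.
rewrite dirE; field; rewrite !gt_eqF //.
Qed.

End SphereCollapse.

(** * Wedge of spheres *)

Lemma cts_collapse (R : realType) (Z : topologicalType) n (p : 'I_n -> R) k0
    (m : Z -> R) (t : Z -> 'I_n -> R) k :
  continuous m -> (forall l, continuous (fun z => t z l)) ->
  (forall z, \sum_l direction p k0 (m z) (t z) l ^+ 2 != 0) ->
  continuous (fun z => collapse p k0 (m z) (t z) k).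
Proof.
move=> cm ct D0.
have cx l : continuous (fun z => t z l - (1 - m z) / n%:R).
  apply: ctsB => //; apply: ctsM; last exact: ctsC.
  by apply: ctsB => //; exact: ctsC.
have cd l : continuous (fun z => direction p k0 (m z) (t z) l).
  rewrite /direction /shear; case: eqP => _ //.
  apply: ctsM; last exact: ctsC.
  apply: ctsB; apply: cts_sum => j _ //.
  by apply: ctsM => //; exact: ctsC.
apply: ctsB; first exact: ctsC.
apply: ctsM => //; apply: ctsM; first by apply: ctsM => //; exact: ctsC.
apply: ctsV => //; apply: cts_sum => l _.
by apply: (eq_continuous _ (ctsM (cd l) (cd l))) => z; rewrite expr2.
Qed.

Section WedgeRetraction.
Variables (J : choiceType) (X : J -> topologicalType) (p : forall j, X j).

(** Sends the other summands to the base point; used to recover every [facet_map j] from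
    [to_wedge]. *)
Definition wedge_retract j : wedge p -> X j := wedge_fun (fun i a => dfwith p i a j).

Lemma wedge_retractE i j (a : X i) :
  wedge_retract j (wedge_lift p a) = dfwith p i a j.
Proof.
rewrite /wedge_retract wedge_lift_funE // => k l.
by rewrite (wedge_prod_pointE p k l).
Qed.

Lemma wedge_lift_surj (w : wedge p) : exists j (a : X j), w = wedge_lift p a.
Proof.
have : [set: wedge p] w by [].
by rewrite -wedgeTE => -[j _ [a _ <-]]; exists j, a.
Qed.

End WedgeRetraction.

Lemma hausdorff_sphere (R : realType) n : hausdorff_space (sphere R n).
Proof.
apply: (@hausdorff_separating _ R 'I_n (fun k x => (set_val x : 'rV[R]_n) ord0 k)).
- exact: Rhausdorff.
- move=> k.
  have cval : continuous (fun x : sphere R n => (set_val x : 'rV[R]_n)).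
    exact: set_val_continuous.
  exact: (cts_comp cval (@mx_entry_continuous R 1 n ord0 k)).
- by move=> x y xy; apply/val_inj/rowP => k; exact: xy.
Qed.

Section WedgeOfFacets.
Variables (R : realType) (V J : finType) (n : J -> nat) (e : forall j, 'I_(n j) -> V).
Variables (K : {set {set V}}) (p : forall j, sphere R (n j)) (j0 : J).

Definition facet j : {set V} := [set e k | k in 'I_(n j)].

Hypothesis K_complex : simplicial_complex K.
Hypothesis n_gt0 : forall j, (0 < n j)%N.
Hypothesis e_inj : forall j, injective (@e j).
Hypothesis facet_inj : injective facet.
Hypothesis facets_K : [set facet j | j in J]%SET \subset facets K.

Let L := K :\: [set facet j | j in J]%SET.
Hypothesis L_contractible : ptcontractible R L.

Implicit Types (t : {ptws V -> R}) (x y : realization R K) (j : J).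

(** Positive exactly in the interior of the facet [j]. By maximality of facets at most one of these
    functions is positive at a given point. *)
Let m j t : R := low (facet j) t.
Let c j k : R := (set_val (p j) : 'rV[R]_(n j)) ord0 k.

Let facetsP j : facet j \in [set facet j | j in J]%SET.
Proof. exact: imset_f. Qed.

Let facet_neq0 j : facet j != finset.set0.
Proof.
by apply/set0Pn; exists (e (Ordinal (n_gt0 j))); apply: imset_f.
Qed.

Let c_norm j : \sum_k @c j k ^+ 2 = 1.
Proof. exact: (set_valP (p j)). Qed.

Let k0_ex j : {k | @c j k != 0}.
Proof.
apply/sigW; apply: contrapT => c0; have /eqP := c_norm j.
rewrite big1 ?(eq_sym 0) ?oner_eq0 // => k _.
by apply/eqP; rewrite sqrf_eq0; apply: contrapT => /negP ck; apply: c0; exists k.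
Qed.
Let k0 j := projT1 (k0_ex j).
Let ck0 j : @c j (k0 j) != 0 := projT2 (k0_ex j).

Let supp_facet j t : points K t -> 0 < m j t ->
  [set v | t v != 0]%SET = facet j.
Proof.
move=> tK; rewrite (low_gt0 _ tK) => jt.
exact: (facet_max facets_K (facetsP j) jt (let: And3 _ _ tS := tK in tS)).
Qed.

Let m_uniq i j t : points K t -> 0 < m i t -> 0 < m j t -> i = j.
Proof. by move=> tK /(supp_facet tK) ti /(supp_facet tK) tj; apply: facet_inj; rewrite -ti. Qed.

Let m_ge0 j t : points K t -> 0 <= m j t.
Proof. exact: low_ge0. Qed.

Let m_eq0 j t : points K t -> ~~ (0 < m j t) -> m j t = 0.
Proof. by move=> tK; rewrite lt_def m_ge0 // andbT negbK => /eqP. Qed.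

Let m_le j t (k : 'I_(n j)) : m j t <= t (e k).
Proof. by apply: low_le; exact: imset_f. Qed.

Let m_attained j t : points K t -> exists k : 'I_(n j), t (e k) = m j t.
Proof.
move=> tK; have [_ /imsetP[k _ ->] mt] := low_attained tK (facet_neq0 j).
by exists k.
Qed.

Let sum_facet j (h : V -> R) : \sum_(v in facet j) h v = \sum_(k < n j) h (e k).
Proof. by rewrite big_imset //= => k l _ _; exact: e_inj. Qed.

Let sum1 j t : points K t -> 0 < m j t -> \sum_(k < n j) t (e k) = 1.
Proof.
move=> tK jt; have [_ t1 _] := tK; rewrite -sum_facet -t1 -(supp_facet tK jt).
rewrite [RHS](bigID (fun v => v \in [set v | t v != 0]%SET)) /=.
by rewrite [X in _ = _ + X]big1 ?addr0 // => v; rewrite inE negbK => /eqP.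
Qed.

Let m_or j t : points K t -> m j t = 0 \/ \sum_(k < n j) t (e k) = 1.
Proof.
move=> tK; case: (boolP (0 < m j t)) => [/(sum1 tK)|/(m_eq0 tK)]; tauto.
Qed.

Lemma pointsL t : points L t <-> points K t /\ forall j, m j t = 0.
Proof.
split=> [[t0 t1]|[[t0 t1 tK] mt]]; last first.
  split=> //; rewrite finset.in_setD tK andbT; apply/imsetP => -[j _ tj].
  have := low_gt0 (facet j) (And3 t0 t1 tK).
  by rewrite -/(m j t) mt ltxx tj subxx.
rewrite finset.in_setD => /andP[tF tK]; split=> // j; apply: m_eq0; first by split.
apply: contraNN tF => jt; rewrite (supp_facet _ jt) //.
Qed.

Definition facet_map j x : sphere R (n j) :=
  exist _ (\row_k collapse (@c j) (k0 j) (m j (set_val x)) (fun k => set_val x (@e j k)) k)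
    (mem_set (etrans (eq_bigr _ (fun k _ => congr1 (fun a => a ^+ 2) (mxE _ _ _ _)))
      (collapse_norm (c_norm j) (ck0 j) (m_or j (points_realization x))))).

Let facet_mapE j x k : (set_val (facet_map j x) : 'rV[R]_(n j)) ord0 k =
  collapse (@c j) (k0 j) (m j (set_val x)) (fun k => set_val x (@e j k)) k.
Proof. by rewrite mxE. Qed.

Let sphere_eq j (a b : sphere R (n j)) :
  (forall k, (set_val a : 'rV[R]_(n j)) ord0 k = (set_val b : 'rV[R]_(n j)) ord0 k) -> a = b.
Proof. by move=> ab; apply/val_inj/rowP => k; exact: ab. Qed.

Let facet_map0 j x : m j (set_val x) = 0 -> facet_map j x = p j.
Proof.
by move=> mx; apply: sphere_eq => k; rewrite facet_mapE mx collapse0.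
Qed.

Let facet_map_neq j x : 0 < m j (set_val x) -> facet_map j x <> p j.
Proof.
move=> mx eqp; apply: (collapse_neq (ck0 j) mx (sum1 (points_realization x) mx)).
by apply/funext => k; rewrite -facet_mapE eqp.
Qed.

Let facet_map_continuous j : continuous (facet_map j).
Proof.
have ct : continuous (fun x : realization R K => set_val x) by exact: set_val_continuous.
apply: continuous_subtype; apply: continuous_mx => i k.
have cE : (fun x => collapse (@c j) (k0 j) (m j (set_val x)) (fun k => set_val x (@e j k)) k)
   =1 (fun x => (set_val (facet_map j x) : 'rV[R]_(n j)) i k).
  by move=> x; rewrite (ord1 i) facet_mapE.
apply: (eq_continuous cE); apply: cts_collapse.
- exact: cts_low.
- move=> l; exact: (cts_comp ct (@cts_eval _ _ (e l))).
- move=> x; have xK := points_realization x; apply: (direction_neq0 (ck0 j)).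
  case: (boolP (0 < m j (set_val x))) => [mx|/(m_eq0 xK) mx].
    by right; split; [rewrite gt_eqF|exact: sum1].
  by left; split=> //; have [k' tk'] := m_attained j xK; exists k'; rewrite tk'.
Qed.

(** The quotient map collapsing [L]: the open facet [j] goes bijectively onto its sphere minus the
    base point, and [L] to the base point, written here in the summand [j0]. *)
Definition to_wedge x : wedge p :=
  if [pick j | 0 < m j (set_val x)] is Some j then wedge_lift p (facet_map j x)
  else wedge_lift p (p j0).

Let to_wedgeE j x : (forall i, i != j -> m i (set_val x) = 0) ->
  to_wedge x = wedge_lift p (facet_map j x).
Proof.
move=> mx; rewrite /to_wedge; case: pickP => [i mi|m0].
  suff -> : i = j by [].
  by apply/eqP; apply: contraTT mi => /mx ->; rewrite ltxx.
rewrite facet_map0; first exact: wedge_liftE.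
by apply: m_eq0; [exact: points_realization|rewrite m0].
Qed.

Let retract_to_wedge j x : wedge_retract j (to_wedge x) = facet_map j x.
Proof.
have xK := points_realization x; rewrite /to_wedge.
case: pickP => [i mi|m0]; rewrite wedge_retractE; case: dfwithP => [|i' ij] //.
- rewrite facet_map0 //; apply: (m_eq0 xK); apply: contraNN ij => mj.
  by rewrite (m_uniq xK mi mj).
- by rewrite facet_map0 //; apply: (m_eq0 xK); rewrite m0.
- by rewrite facet_map0 //; apply: (m_eq0 xK); rewrite m0.
Qed.

Let to_wedgeL x : points L (set_val x) -> to_wedge x = wedge_lift p (p j0).
Proof. by move=> /pointsL[_ mx]; rewrite (@to_wedgeE j0) // facet_map0. Qed.

Let to_wedge_inj x y : to_wedge x = to_wedge y ->
  x = y \/ points L (set_val x) /\ points L (set_val y).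
Proof.
move=> xy; have fxy j : facet_map j x = facet_map j y by rewrite -!retract_to_wedge xy.
have xK := points_realization x; have yK := points_realization y.
have [[j mx]|/forallNP mx] := pselect (exists j, 0 < m j (set_val x)); last first.
  have m0 j : m j (set_val x) = 0 by apply: (m_eq0 xK); apply/negP/mx.
  right; split; apply/pointsL; split=> // j; apply: (m_eq0 yK).
  by apply/negP => /facet_map_neq; rewrite -fxy facet_map0.
have my : 0 < m j (set_val y).
  rewrite -[X in is_true X]negbK; apply/negP => /(m_eq0 yK)/facet_map0.
  by rewrite -fxy => /(facet_map_neq mx).
left; apply/val_inj/funext => v.
have eqe : (fun k => set_val x (@e j k)) = (fun k => set_val y (@e j k)).
  apply: (collapse_inj (ck0 j) mx my); rewrite ?sum1 //.
  - exact: m_attained.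
  - exact: m_attained.
  - by apply/funext => k; rewrite -!facet_mapE fxy.
have [/imsetP[k _ ->]|] := boolP (v \in facet j); first exact: (congr1 (@^~ k) eqe).
move=> vF; have := vF; rewrite -{1}(supp_facet xK mx) inE negbK => /eqP xv.
by move: vF; rewrite -(supp_facet yK my) inE negbK => /eqP yv; rewrite [LHS]xv [RHS]yv.
Qed.

Let to_wedge_surj w : exists x, to_wedge x = w.
Proof.
have [j [z ->]] := wedge_lift_surj w.
have [->|/eqP zp] := eqVneq z (p j).
  have [_ [t0 [_ t0L _ _ _]]] := L_contractible.
  have /pointsL[t0K _] := t0L.
  by exists (realize t0K); rewrite to_wedgeL //; exact: (wedge_liftE p (p j) (p j0)).
have [||mm [t [mm0 t1 mmt [k tk] tz]]] := collapse_surj (c_norm j) (ck0 j)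
    (z := fun k => (set_val z : 'rV[R]_(n j)) ord0 k).
- exact: (set_valP z).
- by move=> zc; apply: zp; apply: sphere_eq => k; exact: (congr1 (@^~ k) zc).
pose u : {ptws V -> R} := fun v => \sum_k t k * (v == e k)%:R.
have ue k' : u (e k') = t k'.
  rewrite /u (bigD1 k') //= eqxx mulr1 big1 ?addr0 // => l lk.
  by rewrite (inj_eq (@e_inj j)) eq_sym (negPf lk) mulr0.
have uN v : v \notin facet j -> u v = 0.
  move=> vF; rewrite /u big1 // => l _; case: eqP => [vl|]; last by rewrite mulr0.
  by case/negP: vF; rewrite vl imset_f.
have suppu : [set v | u v != 0]%SET = facet j.
  apply/setP => v; rewrite inE; have [/imsetP[l _ ->]|/uN ->] := boolP (v \in facet j).
    by rewrite ue gt_eqF // (lt_le_trans mm0).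
  by rewrite eqxx.
have uK : points K u.
  split=> [v||].
  - by apply: sumr_ge0 => l _; rewrite mulr_ge0 ?ler0n // (le_trans (ltW mm0)).
  - rewrite exchange_big /= -[RHS]t1; apply: eq_bigr => l _.
    by rewrite -mulr_sumr sum_indicator mulr1.
  - by rewrite suppu; apply: (facet_simplex facets_K).
have mu : m j u = mm.
  apply/le_anti/andP; split; first by rewrite -tk -ue m_le.
  by have [l <-] := m_attained j uK; rewrite ue.
exists (realize uK); rewrite (@to_wedgeE j) => [|i ij].
  congr wedge_lift; apply: sphere_eq => l; rewrite facet_mapE /= mu.
  rewrite -[RHS](congr1 (@^~ l) tz); congr collapse; apply/funext => l'; exact: ue.
apply: (m_eq0 uK); apply: contraNN ij => mi.
by rewrite (m_uniq uK mi (_ : 0 < m j u)) // mu.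
Qed.

(** Gluing over a finite closed cover: where all [m i] with [i != j] vanish, the map is
    [facet_map j] followed by the inclusion of the summand. *)
Let to_wedge_continuous : continuous to_wedge.
Proof.
apply/continuous_closedP => C cC.
rewrite (_ : _ @^-1` _ = \bigcup_(j in [set: J])
   ((\bigcap_(i in [set i | i != j]) [set x | m i (set_val x) = 0]) `&`
    (fun x => wedge_lift p (facet_map j x)) @^-1` C)); last first.
  apply/seteqP; split=> [x Cx|x [j _ [mx]]]; last by rewrite /= -to_wedgeE.
  have xK := points_realization x.
  have [[j mx]|/forallNP mx] := pselect (exists j, 0 < m j (set_val x)).
    have m0 i : i != j -> m i (set_val x) = 0.
      move=> ij; apply: (m_eq0 xK); apply: contraNN ij => mi.
      by rewrite (m_uniq xK mi mx).
    by exists j => //; split => //=; rewrite -(to_wedgeE m0).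
  have m0 i : m i (set_val x) = 0 by apply: (m_eq0 xK); apply/negP/mx.
  by exists j0 => //; split=> [i _|/=]; [exact: m0|rewrite -(@to_wedgeE j0)].
apply: closed_bigcup; first exact: finite_finset.
move=> j _; apply: closedI.
  apply: closed_bigI => i _.
  apply: (@preimage_closed (realization R K) R (fun x => m i (set_val x)) [set 0]) => [x _|].
    by apply: cts_low; exact: set_val_continuous.
  exact: closed_eq.
apply: preimage_closed => // x _.
apply: continuous_comp; first exact: facet_map_continuous.
exact: wedge_lift_continuous.
Qed.

Let N : R := #|V|%:R.

Let N_ge1 : 1 <= N.
Proof. by rewrite ler1n; apply/card_gt0P; exists (e (Ordinal (n_gt0 j0))). Qed.

Let card_facet j : #|facet j| = n j.
Proof. by rewrite /facet card_imset ?card_ord //; exact: e_inj. Qed.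

Let n_le j : (n j)%:R <= N.
Proof. by rewrite ler_nat -card_facet max_card. Qed.

(** The bound [s / (2 * N)] keeps the mass removed from a facet at most 1/2 for [s <= 1], so
    [deflate] divides by a positive number. *)
Let cut j t (s : R) : R := Num.min (m j t) (s / (2 * N)).

(** Summing over all facets avoids choosing one and keeps the formula continuous; at a point of [K]
    at most one term is nonzero. *)
Let deflate t (s : R) : {ptws V -> R} := fun v =>
  (t v - \sum_j cut j t s * (v \in facet j)%:R) / (1 - \sum_j (n j)%:R * cut j t s).

(** The time left once [deflate] has brought the point into [L], and 0 before that moment. *)
Let delay t (s : R) : R := clamp (s - 2 * N * \sum_j m j t).

Let sum_only j t (F : J -> R -> R) : points K t -> 0 < m j t -> (forall i, F i 0 = 0) ->
  \sum_i F i (m i t) = F j (m j t).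
Proof.
move=> tK mj F0; rewrite (bigD1 j) //= big1 ?addr0 // => i ij.
rewrite m_eq0 //; apply: contraNN ij => mi; by rewrite (m_uniq tK mi mj).
Qed.

Let N2_gt0 : 0 < 2 * N.
Proof. by rewrite mulr_gt0 // (lt_le_trans ltr01). Qed.

Let cut0 s : 0 <= s -> Num.min 0 (s / (2 * N)) = 0.
Proof. by move=> s0; rewrite min_l // divr_ge0 // ltW. Qed.

Let cut_ge0 j t s : points K t -> 0 <= s -> 0 <= cut j t s.
Proof. by move=> tK s0; rewrite le_min m_ge0 //= divr_ge0 // ltW. Qed.

Let cut_le j t s : points K t -> 0 <= s <= 1 -> (n j)%:R * cut j t s <= 2^-1.
Proof.
move=> tK /andP[s0 s1]; apply: le_trans (_ : N * (1 / (2 * N)) <= _); last first.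
  by rewrite div1r invfM mulrCA divff ?mulr1 // gt_eqF // (lt_le_trans ltr01).
apply: ler_pM => //; first exact: cut_ge0.
rewrite ge_min; apply/orP; right.
by rewrite ler_pM2r // invr_gt0.
Qed.

Let deflate_facet j t s : points K t -> 0 < m j t -> 0 <= s ->
  deflate t s = (fun v => (t v - cut j t s * (v \in facet j)%:R) / (1 - (n j)%:R * cut j t s)).
Proof.
move=> tK mj s0; apply/funext => v; rewrite /deflate /cut.
rewrite (@sum_only j t (fun i a => Num.min a (s / (2 * N)) * (v \in facet i)%:R)) //.
  rewrite (@sum_only j t (fun i a => (n i)%:R * Num.min a (s / (2 * N)))) //.
  by move=> i; rewrite cut0 // mulr0.
by move=> i; rewrite cut0 // mul0r.
Qed.

Let deflate_id t s : (forall j, cut j t s = 0) -> deflate t s = t.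
Proof.
move=> cut_0; apply/funext => v; rewrite /deflate !big1 ?subr0 ?divr1 // => j _.
  by rewrite cut_0 ?mul0r ?mulr0.
by rewrite cut_0 ?mul0r ?mulr0.
Qed.

Let deflate_points t s : points K t -> 0 <= s <= 1 -> points K (deflate t s).
Proof.
move=> tK s01; have /andP[s0 s1] := s01.
have [[j mj]|/forallNP mx] := pselect (exists j, 0 < m j t); last first.
  rewrite deflate_id // => j; rewrite /cut m_eq0 ?cut0 //; exact/negP/mx.
have [t0 t1 tS] := tK; rewrite (deflate_facet tK mj) //.
have den_gt0 : 0 < 1 - (n j)%:R * cut j t s.
  by have := cut_le j tK s01; lra.
split=> [v||].
- rewrite divr_ge0 ?(ltW den_gt0) // subr_ge0.
  have [/imsetP[k _ ->]|_] := boolP (v \in facet j); last by rewrite mulr0.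
  by rewrite mulr1 ge_min m_le.
- rewrite -mulr_suml big_split /= sumrN -mulr_sumr sum_indicator_set card_facet t1.
  by rewrite mulrC [cut _ _ _ * _]mulrC mulVf // gt_eqF.
- apply: K_complex tS; apply/fintype.subsetP => v; rewrite !inE; apply: contraNN => tv.
  rewrite (eqP tv) (_ : v \in facet j = false) ?mulr0 ?subr0 ?mul0r //.
  by rewrite -(supp_facet tK mj) inE tv.
Qed.

Let deflate_pointsL t s : points K t -> 0 <= s <= 1 ->
  2 * N * \sum_j m j t <= s -> points L (deflate t s).
Proof.
move=> tK s01 mt; have /andP[s0 s1] := s01.
have [[j mj]|/forallNP mx] := pselect (exists j, 0 < m j t); last first.
  have m0 j : m j t = 0 by rewrite m_eq0 //; exact/negP/mx.
  rewrite deflate_id; last by move=> j; rewrite /cut m0 ?cut0.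
  by apply/pointsL.
have cutj : cut j t s = m j t.
  rewrite /cut min_l // ler_pdivlMr // mulrC.
  by rewrite (@sum_only j t (fun _ a => a)) in mt.
have dK := deflate_points tK s01.
apply/pointsL; split=> // i; apply: m_eq0 => //; apply/negP => mi.
have supp_d := supp_facet dK mi.
have [k tk] := m_attained j tK.
have dk : deflate t s (e k) = 0.
  by rewrite (deflate_facet tK mj) // cutj imset_f // mulr1 tk subrr mul0r.
have ij : facet i \subset facet j.
  rewrite -supp_d -(supp_facet tK mj); apply/fintype.subsetP => v; rewrite !inE.
  apply: contraNN => /eqP tv; rewrite (deflate_facet tK mj) // tv.
  rewrite (_ : v \in facet j = false) ?mulr0 ?subr0 ?mul0r //.
  by rewrite -(supp_facet tK mj) inE tv eqxx.
have ji := facet_max facets_K (facetsP i) ij (facet_simplex facets_K (facetsP j)).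
have : e k \in facet j by exact: imset_f.
by rewrite ji -supp_d inE dk eqxx.
Qed.

(* The contraction of [L] is extended to [K] by deflating each facet: a collar
   of width [s / 2N] around its boundary is swept by the contraction. *)
Lemma flow_exists : exists (H : realization R K * R -> realization R K) (x0 : realization R K),
  [/\ continuous H, forall x, H (x, 0) = x,
      forall x, points L (set_val x) -> H (x, 1) = x0
    & forall x s, points L (set_val x) -> points L (set_val (H (x, s)))].
Proof.
have [C [t0 [cC t0L C0 C1 CL]]] := L_contractible.
pose h (z : realization R K * R) : {ptws V -> R} :=
  let s := clamp z.2 in C (deflate (set_val z.1) s, delay (set_val z.1) s).
have LK t : points L t -> points K t by move=> /pointsL[].
have hK z : points K (h z).
  have s01 := clamp_itv z.2; have tK := points_realization z.1.
  (* Either the deflated point is in [L], which [C] preserves, or the delay is 0 and [C] has not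
     started. *)
  rewrite /h; have [le_s|lt_s] := lerP (2 * N * \sum_j m j (set_val z.1)) (clamp z.2).
    by apply: LK; apply: CL; [exact: deflate_pointsL|exact: clamp_itv].
  rewrite /delay [X in C (_, X)]clamp_le0 ?C0; first exact: deflate_points.
  by rewrite subr_le0 ltW.
have hL x s : points L (set_val x) -> h (x, s) = C (set_val x, clamp s).
  move=> /pointsL[tK m0]; rewrite /h /= /delay big1 // mulr0 subr0.
  have s01 := clamp_itv s; have /andP[s0 _] := s01.
  by rewrite (@clamp_id _ (clamp s)) // deflate_id // => j; rewrite /cut m0 cut0.
exists (fun z => realize (hK z)), (realize (LK _ t0L)); split.
- apply: continuous_subtype; apply: (@cts_comp _ _ _ (fun z : realization R K * R =>
    (deflate (set_val z.1) (clamp z.2), delay (set_val z.1) (clamp z.2))) C) => //.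
  have cs : continuous (fun z : realization R K * R => clamp z.2).
    by apply: cts_clamp; exact: snd_continuous.
  have ct : continuous (fun z : realization R K * R => set_val z.1 : {ptws V -> R}).
    by apply: cts_comp; [exact: fst_continuous|exact: set_val_continuous].
  have cm j : continuous (fun z : realization R K * R => m j (set_val z.1)).
    exact: cts_low.
  have ccut j : continuous (fun z : realization R K * R => cut j (set_val z.1) (clamp z.2)).
    by apply: cts_min => //; apply: ctsM => //; exact: ctsC.
  apply: pair_continuous.
    apply: continuous_prod => v; apply: ctsM.
      apply: ctsB; first exact: (cts_comp ct (@cts_eval _ _ v)).
      by apply: cts_sum => j _; apply: ctsM => //; exact: ctsC.
    apply: ctsV.
      move=> z; have tK := points_realization z.1; have s01 := clamp_itv z.2.
      have [[j mj]|/forallNP mx] := pselect (exists j, 0 < m j (set_val z.1)); last first.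
        rewrite big1 ?subr0 ?oner_neq0 // => j _; rewrite /cut m_eq0 ?cut0 ?mulr0 //.
          by have /andP[] := s01.
        exact/negP/mx.
      rewrite /cut (@sum_only j _ (fun i a => (n i)%:R * Num.min a (clamp z.2 / (2 * N)))) //.
        by rewrite gt_eqF //; have := cut_le j tK s01; rewrite /cut; lra.
      by move=> i; rewrite cut0 ?mulr0 //; have /andP[] := s01.
    apply: ctsB; first exact: ctsC.
    by apply: cts_sum => j _; apply: ctsM => //; exact: ctsC.
  apply: cts_clamp; apply: ctsB => //; apply: ctsM; first exact: ctsC.
  by apply: cts_sum => j _.
- move=> x; apply/val_inj; have tK := points_realization x.
  rewrite /= /h /= (@clamp_le0 _ 0) // /delay clamp_le0; last first.
    rewrite sub0r oppr_le0 mulr_ge0 ?(ltW N2_gt0) // sumr_ge0 // => j _.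
    exact: m_ge0.
  rewrite C0 deflate_id // => j; rewrite /cut mul0r min_r //; exact: m_ge0.
- by move=> x xL; apply/val_inj; rewrite /= hL // clamp_ge1 // C1.
- by move=> x s xL; rewrite -[set_val _]/(h (x, s)) hL //; apply: CL => //; exact: clamp_itv.
Qed.

Lemma wedge_of_facets : homotopy_equivalent R (realization R K) (wedge p).
Proof.
have [H [x0 [cH H0 H1 HL]]] := flow_exists.
have cK := compact_realization K_complex (R := R).
have hW : hausdorff_space (wedge p) by apply: wedge_hausdorff => j; exact: hausdorff_sphere.
(* An arbitrary section, in general not continuous. It disappears after composition with [to_wedge],
   since the flow respects the fibres, and [continuous_descent] then gives continuity. *)
pose sel w := projT1 (cid (to_wedge_surj w)).
have selK w : to_wedge (sel w) = w by rewrite /sel; case: cid.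
have sel_to x : sel (to_wedge x) = x \/
    points L (set_val (sel (to_wedge x))) /\ points L (set_val x).
  exact/to_wedge_inj/selK.
pose G (w : wedge p) := H (sel w, 1).
have cslice (X : topologicalType) (r : R) : continuous (fun x : X => (x, r)).
  by apply: pair_continuous => [x|]; [exact: cvg_id|exact: cst_continuous].
have Gq x : G (to_wedge x) = H (x, 1).
  by rewrite /G; have [->//|[? ?]] := sel_to x; rewrite !H1.
exists to_wedge, G; split; first exact: to_wedge_continuous.
- have cGfst : continuous (fun z : wedge p * R => G z.1).
    apply: (continuous_descent cK hW to_wedge_continuous to_wedge_surj) => /=.
    apply: (eq_continuous (f := fun z : realization R K * R => H (z.1, 1))).
      by move=> z; rewrite Gq.
    exact: (cts_comp (cts_comp (@fst_continuous _ R) (@cslice _ 1)) cH).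
  exact: (cts_comp (@cslice _ 0) cGfst).
- apply: (homotopic_of_continuous cH) => // x; exact/esym/Gq.
- pose D (z : wedge p * R) := to_wedge (H (sel z.1, z.2)).
  have cD : continuous D.
    apply: (continuous_descent cK hW to_wedge_continuous to_wedge_surj).
    apply: (eq_continuous (f := fun z : realization R K * R => to_wedge (H z))).
      move=> [x s]; rewrite /D /=; have [->//|[sL xL]] := sel_to x.
      by rewrite (to_wedgeL (HL x s xL)) (to_wedgeL (HL _ s sL)).
    exact: (cts_comp cH to_wedge_continuous).
  apply: (homotopic_of_continuous cD) => w; first by [].
  by rewrite /D /= H0 selK.
Qed.

End WedgeOfFacets.

End Topology.

(** * The augmented Bergman complex *)

(* [Collapse] removes the open star of [A], on which toggling [a] is a perfect
   matching. *)
Inductive collapsible (V : finType) : {set {set V}} -> Prop :=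
| Cone K a of simplicial_complex K & K != finset.set0 & (forall S, S \in K -> a |: S \in K) :
    collapsible K
| Collapse K (A : {set V}) a of simplicial_complex K & A != finset.set0 & a \notin A &
    (forall S, S \in K -> A \subset S -> a |: S \in K) &
    collapsible [set S in K | ~~ (A \subset S)] : collapsible K.

Lemma collapsible_contractible (R : realType) (V : finType) (K : {set {set V}}) :
  collapsible K -> ptcontractible R K.
Proof.
elim=> {K} [K a|K A a Kc A0 aA aK _]; first exact: cone_contractible.
exact: (collapse_contractible Kc A0 aA aK).
Qed.

Lemma collapsible_acyclic (V : finType) (K : {set {set V}}) :
  collapsible K -> acyclic K.
Proof.
elim=> {K} [K a _ _|K A a Kc _ aA aK _]; first exact: cone_acyclic.
exact: (collapse_acyclic Kc aA aK).
Qed.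

Section Bergman.
Variables (E : finType) (f : {set E} -> {set E}).
Hypothesis f_closure : closure_operator f.
Implicit Types (I A B F : {set E}) (II FF : {set {set E}}) (S T : {set bergman_vertex E}).

Let f_ext A : A \subset f A. Proof. by case: f_closure. Qed.
Let f_mono A B : A \subset B -> f A \subset f B.
Proof. by case: f_closure => _ + _; apply. Qed.
Let f_idem A : f (f A) = f A. Proof. by case: f_closure. Qed.

Let f_min A F : f F = F -> A \subset F -> f A \subset F.
Proof. by move=> <- /f_mono; rewrite f_idem. Qed.

Let f_setT : f [set: E] = [set: E].
Proof. by apply/eqP; rewrite -finset.subTset f_ext. Qed.

Lemma independentsP I :
  reflect (forall i, i \in I -> i \notin f (I :\ i)) (I \in independents f).
Proof.
rewrite inE; apply: (iffP forall_inP) => indI i iI; have := indI i iI.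
  apply: contraTN => ifI; rewrite properE (f_mono (finset.subsetDl _ _)) /= negbK.
  apply: f_min => //; rewrite -{1}(finset.setD1K iI) finset.subUset finset.sub1set ifI.
  exact: f_ext.
rewrite properE (f_mono (finset.subsetDl _ _)) /=; apply: contraNN => /fintype.subsetP.
by apply; apply: (fintype.subsetP (f_ext I)).
Qed.

Lemma independents_sub A I : A \subset I -> I \in independents f -> A \in independents f.
Proof.
move=> AI /independentsP indI; apply/independentsP => i iA.
apply: contraNN (indI i (fintype.subsetP AI i iA)).
by apply/fintype.subsetP/f_mono/finset.setSD.
Qed.

Definition y_part S : {set E} := [set i | inl i \in S].
Definition x_part S : {set {set E}} := [set F | inr F \in S].

Lemma y_part_simplex I FF : y_part (bergman_simplex I FF) = I.
Proof.
apply/setP => i; rewrite !inE; apply/orP/idP => [[/imsetP[j jI [->]]|/imsetP[]]|iI] //.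
by left; exact: imset_f.
Qed.

Lemma x_part_simplex I FF : x_part (bergman_simplex I FF) = FF.
Proof.
apply/setP => i; rewrite !inE; apply/orP/idP => [[/imsetP[]|/imsetP[j jI [->]]]|iI] //.
by right; exact: imset_f.
Qed.

Lemma simplexE S : S = bergman_simplex (y_part S) (x_part S).
Proof.
apply/setP => -[i|F]; rewrite !inE.
- apply/idP/orP => [iS|[/imsetP[j +] [->]|/imsetP[]//]]; last by rewrite inE.
  by left; apply: imset_f; rewrite inE.
- apply/idP/orP => [iS|[/imsetP[]//|/imsetP[j +] [->]]]; last by rewrite inE.
  by right; apply: imset_f; rewrite inE.
Qed.

Lemma bergmanE S : (S \in bergman f) =
  [&& y_part S \in independents f, flag f (x_part S) &
      [forall F in x_part S, y_part S \subset F]].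
Proof.
apply/imset2P/and3P => [[I FF II]|[yI xF yx]].
  rewrite inE => /andP[FFf IFF] ->.
  by rewrite y_part_simplex x_part_simplex.
exists (y_part S) (x_part S) => //; last exact: simplexE.
by rewrite inE; apply/andP.
Qed.

Lemma y_part_sub S T : S \subset T -> y_part S \subset y_part T.
Proof. by move=> /fintype.subsetP ST; apply/fintype.subsetP => i; rewrite !inE => /ST. Qed.

Lemma x_part_sub S T : S \subset T -> x_part S \subset x_part T.
Proof. by move=> /fintype.subsetP ST; apply/fintype.subsetP => i; rewrite !inE => /ST. Qed.

Lemma bergman_complex : simplicial_complex (bergman f).
Proof.
move=> T S ST; rewrite !bergmanE => /and3P[yI /andP[xF xc] yx]; apply/and3P.
have xST := fintype.subsetP (x_part_sub ST).
split; first exact: independents_sub (y_part_sub ST) yI.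
- apply/andP; split; first exact: fintype.subset_trans (x_part_sub ST) xF.
  apply/forall_inP => F /xST FT; apply/forall_inP => G /xST GT.
  exact: (forall_inP (forall_inP xc F FT) G GT).
- apply/forall_inP => F /xST FT.
  exact: fintype.subset_trans (y_part_sub ST) (forall_inP yx F FT).
Qed.

Lemma basis_simplexE B : basis_simplex B = bergman_simplex B finset.set0.
Proof. by rewrite /bergman_simplex imset0 finset.setU0. Qed.

(** A closed set containing a spanning set is [E], which is not a vertex, so no [x] vertex can
    occur. *)
Lemma bergman_spanning S : S \in bergman f -> f (y_part S) = [set: E] ->
  S = basis_simplex (y_part S).
Proof.
rewrite bergmanE => /and3P[_ /andP[xF _] yx] fy.
rewrite {1}[S]simplexE basis_simplexE; congr bergman_simplex.
apply/eqP; rewrite -finset.subset0; apply/fintype.subsetP => F FS.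
have := fintype.subsetP xF F FS; rewrite !inE => /andP[/negP nFT /eqP fF].
case: nFT; rewrite -finset.subTset -fy; apply: f_min => //.
exact: (forall_inP yx F FS).
Qed.

Let BB := [set basis_simplex B | B in bases f].

(** A simplex above a basis spans, hence has only [y] vertices; an extra one would lie in the
    closure of the others, against independence. *)
Lemma basis_facets : BB \subset facets (bergman f).
Proof.
apply/fintype.subsetP => _ /imsetP[B + ->]; rewrite !inE => /andP[indB /eqP fB].
apply/maxsetP; split.
  rewrite bergmanE basis_simplexE y_part_simplex x_part_simplex inE indB /=.
  rewrite /flag finset.sub0set /=.
  by apply/andP; split; apply/forall_inP => F; rewrite inE.
move=> S SK BS; have By : B \subset y_part S.
  by rewrite -[B](y_part_simplex B finset.set0) -basis_simplexE y_part_sub.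
have fy : f (y_part S) = [set: E].
  by apply/eqP; rewrite -finset.subTset -fB f_mono.
rewrite (bergman_spanning SK fy); congr basis_simplex.
apply/eqP; rewrite finset.eqEsubset By andbT; apply/fintype.subsetP => i iS.
move: SK; rewrite bergmanE => /and3P[/independentsP/(_ i iS) + _ _].
apply: contraNT => iB; suff -> : f (y_part S :\ i) = [set: E] by rewrite inE.
by apply/eqP; rewrite -finset.subTset -fB f_mono // finset.subsetD1 By.
Qed.

Lemma bergmanD_bases S : (S \in bergman f :\: BB) =
  (S \in bergman f) && (f (y_part S) != [set: E]).
Proof.
rewrite finset.in_setD andbC; have [SK/=|//] := boolP (S \in bergman f).
congr negb; apply/imsetP/eqP => [[B]|fy].
  by rewrite inE => /andP[_ /eqP fB] ->; rewrite basis_simplexE y_part_simplex.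
exists (y_part S); last exact: bergman_spanning.
by rewrite inE fy eqxx andbT; move: SK; rewrite bergmanE => /and3P[].
Qed.

(** The stages of the collapse; [II] holds the [y] parts not yet removed. *)
Definition bergman_over (II : {set {set E}}) : {set {set bergman_vertex E}} :=
  [set S in bergman f :\: BB | y_part S \in II].

Lemma bergman_over_complex II : (forall I A, I \in II -> A \subset I -> A \in II) ->
  simplicial_complex (bergman_over II).
Proof.
move=> IIc S T TS; rewrite [S \in _]inE => /andP[SK SII].
rewrite inE (IIc _ _ SII) ?y_part_sub // andbT.
exact: (complex_setD_facets bergman_complex basis_facets TS).
Qed.

(** Every closed set in the flag contains the [y] part and hence its closure, which can therefore be
    put at the bottom of the flag. It is not [E] because the [y] part does not span. *)
Lemma adjoin_closure S II : S \in bergman_over II ->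
  inr (f (y_part S)) |: S \in bergman_over II.
Proof.
rewrite inE bergmanD_bases => /andP[/andP[SK fy] SII].
have yE : y_part (inr (f (y_part S)) |: S) = y_part S by apply/setP => i; rewrite !inE.
have xE : x_part (inr (f (y_part S)) |: S) = f (y_part S) |: x_part S.
  by apply/setP => F; rewrite !inE.
rewrite inE bergmanD_bases yE SII fy !andbT bergmanE yE xE.
move: SK; rewrite bergmanE => /and3P[-> /andP[xF xc] yx] /=.
have fF F : F \in x_part S -> f (y_part S) \subset F.
  move=> FS; have := fintype.subsetP xF F FS; rewrite !inE => /andP[_ /eqP fF].
  by apply: f_min => //; exact: (forall_inP yx).
apply/andP; split; last first.
  apply/forall_inP => F; rewrite finset.in_setU1 => /predU1P[->|FS].
    exact: f_ext.
  exact: (forall_inP yx).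
apply/andP; split.
  by rewrite finset.subUset xF finset.sub1set !inE fy f_idem eqxx.
apply/forall_inP => F; rewrite finset.in_setU1 => /predU1P[->|FS].
  apply/forall_inP => G; rewrite finset.in_setU1 => /predU1P[->|/fF ->//].
  by rewrite fintype.subxx.
apply/forall_inP => G; rewrite finset.in_setU1 => /predU1P[->|GS].
  by rewrite (fF _ FS) orbT.
exact: (forall_inP (forall_inP xc F FS) G GS).
Qed.

Hypothesis f0 : f finset.set0 != [set: E].

Lemma bergman_over_collapsible II : finset.set0 \in II ->
  (forall I A, I \in II -> A \subset I -> A \in II) -> collapsible (bergman_over II).
Proof.
have [k] := ubnP #|II|; elim: k II => // k IHk II; rewrite ltnS => leII II0 IIc.
have Kc := bergman_over_complex IIc.
have [/existsP[I0 /andP[I0I I0n]]|] := boolP [exists I, (I \in II) && (I != finset.set0)].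
  pose I := [arg max_(I > I0 | (I \in II) && (I != finset.set0)) #|I|].
  have [/andP[III In0] Imax] : (I \in II) && (I != finset.set0) /\
      forall I', (I' \in II) && (I' != finset.set0) -> (#|I'| <= #|I|)%N.
    by rewrite /I; case: arg_maxnP => [|I' PI' maxI']; [rewrite I0I|].
  (* By maximality of [I] the simplices in this open star all have [y] part [I], so they share the
     apex [f I]. *)
  have Isub S : S \in bergman_over II -> (inl @: I \subset S) = (y_part S == I).
    rewrite inE => /andP[_ SII]; apply/fintype.subsetP/eqP => [IS|<- _ /imsetP[i + ->]].
      have IyS : I \subset y_part S.
        by apply/fintype.subsetP => i iI; rewrite inE IS // imset_f.
      apply/esym/eqP; rewrite eqEcard IyS /= Imax // SII -card_gt0.
      by rewrite (leq_trans _ (subset_leq_card IyS)) // card_gt0.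
    by rewrite inE.
  apply: (@Collapse _ _ (inl @: I) (inr (f I))) => //.
  - by rewrite imset_eq0.
  - by apply/imsetP => -[].
  - move=> S SK; rewrite Isub // => /eqP <-; exact: adjoin_closure.
  rewrite (_ : [set S in _ | _] = bergman_over (II :\ I)).
    apply: IHk.
    - by rewrite (cardsD1 I II) III in leII.
    - by rewrite !inE eq_sym In0.
    - move=> A A'; rewrite !inE => /andP[AI AII] A'A; rewrite (IIc _ _ AII A'A) andbT.
      apply: contraNneq AI => A'I; rewrite eq_sym eqEcard -{1}A'I A'A Imax // AII -card_gt0.
      by rewrite (leq_trans _ (subset_leq_card A'A)) // A'I card_gt0.
  apply/setP => S; rewrite inE [RHS]inE; case: (boolP (S \in bergman_over II)) => SK.
    by rewrite Isub //; move: SK; rewrite !inE => /andP[-> ->]; rewrite andbT.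
  apply/esym/negbTE; apply: contraNN SK => /andP[SD]; rewrite finset.in_setD1 => /andP[_ SII].
  by rewrite inE SD.
rewrite negb_exists => /forallP II1.
have y0 S : S \in bergman_over II -> y_part S = finset.set0.
  rewrite inE => /andP[_ SII]; apply/eqP; have := II1 (y_part S).
  by rewrite SII /= negbK.
apply: (@Cone _ _ (inr (f finset.set0))) => //.
  (* By [f0] the empty simplex is not that of a basis, so the final cone is not void. *)
  apply/set0Pn; exists finset.set0; rewrite inE bergmanD_bases.
  have -> : y_part finset.set0 = finset.set0 by apply/setP => i; rewrite !inE.
  rewrite II0 f0 !andbT bergmanE.
  have -> : y_part finset.set0 = finset.set0 by apply/setP => i; rewrite !inE.
  have -> : x_part finset.set0 = finset.set0 by apply/setP => i; rewrite !inE.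
  apply/and3P; split; first by apply/independentsP => i; rewrite inE.
  - by apply/andP; split; [exact: finset.sub0set|apply/forall_inP => F; rewrite inE].
  - by apply/forall_inP => F; rewrite inE.
by move=> S SK; rewrite -(y0 S SK); exact: adjoin_closure.
Qed.

Lemma bergmanD_bases_collapsible : collapsible (bergman f :\: BB).
Proof.
rewrite (_ : _ :\: _ = bergman_over (independents f)).
  apply: bergman_over_collapsible => [|I A II AI]; last exact: independents_sub II.
  by apply/independentsP => i; rewrite inE.
apply/setP => S; rewrite [RHS]inE bergmanD_bases; have [|//] := boolP (S \in bergman f).
by rewrite bergmanE => /and3P[-> _ _]; rewrite andbT.
Qed.

(** A spanning set of least cardinality is independent. It provides the summand in which the base
    point of the wedge is written. *)
Lemma bases_exist : exists B, B \in bases f.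
Proof.
pose B := [arg min_(B < [set: E] | f B == [set: E]) #|B|].
have [/eqP fB Bmin] : f B == [set: E] /\ forall A, f A == [set: E] -> (#|B| <= #|A|)%N.
  by rewrite /B; case: arg_minnP => [|A fA minA]; [rewrite f_setT|].
exists B; rewrite !inE fB eqxx andbT; apply/forall_inP => i iB.
rewrite finset.properT; apply/negP => /Bmin; by rewrite (cardsD1 i B) iB ltnn.
Qed.

End Bergman.

Lemma empty_homotopy_equivalent (R : realType) (X Y : topologicalType) :
  (X -> False) -> (Y -> False) -> homotopy_equivalent R X Y.
Proof.
move=> X0 Y0; exists (fun x => match X0 x with end), (fun y => match Y0 y with end).
split=> [x|y||]; [by case: (X0 x)|by case: (Y0 y)| |].
- exists (fun z => z.1); split=> [|x|x]; try by case: (X0 x).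
  exact/continuous_subspaceT/fst_continuous.
- exists (fun z => z.1); split=> [|y|y]; try by case: (Y0 y).
  exact/continuous_subspaceT/fst_continuous.
Qed.

Lemma sphere0_empty (R : realType) : sphere R 0 -> False.
Proof.
by move=> x; have /= := set_valP x; rewrite big_ord0 => /esym/eqP; rewrite oner_eq0.
Qed.

(** * Equivariant identification of the homology with the span of the bases *)

Section BasisHomology.
Variables (E : finType) (f : {set E} -> {set E}).
Hypothesis f_closure : closure_operator f.
Let BB := [set basis_simplex B | B in bases f].

Lemma basis_simplex_inj : injective (@basis_simplex E).
Proof. by apply: imset_inj => i j []. Qed.

Lemma card_basis_simplex (B : {set E}) : #|basis_simplex B| = #|B|.
Proof. by rewrite card_imset // => i j []. Qed.

Lemma basis_chainE (B : {set E}) : exists e : bool, forall T,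
  basis_chain B T = (-1) ^+ e * (T == basis_simplex B)%:R.
Proof.
have inj_y : injective (fun j : 'I_#|B| => inl (enum_val j) : bergman_vertex E).
  by move=> j k [] /enum_val_inj.
have [e eE] := oriented_inj inj_y; exists e => T; rewrite eE; congr (_ * (_ == _)%:R).
apply/setP => v; apply/imsetP/imsetP => [[j _ ->]|[i iB ->]].
  by exists (enum_val j); rewrite ?enum_valP.
by exists (enum_rank_in iB i); rewrite ?enum_rankK_in.
Qed.

Lemma basis_spanP i c : basis_span f i c <-> c \in chains BB i.
Proof.
split=> [[a ->]|cBB].
  apply: rpred_sum => B /andP[Bf /eqP <-]; rewrite rpredMz //.
  apply/chainsP => T; have [e ->] := basis_chainE B.
  have [->|] := eqVneq T (basis_simplex B); last by rewrite mulr0 eqxx.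
  by rewrite card_basis_simplex imset_f.
(* [basis_chain B] is the reference basis element up to a sign; multiplying the coefficient by this
   same sign cancels it. *)
exists (fun B => basis_chain B (basis_simplex B) * c (basis_simplex B)).
apply/ffunP => T; rewrite sum_ffunE; have [cT|cT] := eqVneq (c T) 0.
  rewrite big1 // => B /andP[Bf _]; rewrite chainMzE; have [e eE] := basis_chainE B.
  by rewrite eE; have [<-|] := eqVneq T; rewrite ?cT ?mulr0 ?mul0r.
have [/imsetP[B Bf TE] Ti] := chainsP _ _ _ cBB T cT.
rewrite (bigD1 B) /=; last by rewrite Bf -card_basis_simplex -TE Ti eqxx.
rewrite big1 ?addr0 => [|B' /andP[_ BB']]; rewrite chainMzE.
  rewrite TE; have [e ->] := basis_chainE B; rewrite eqxx mulr1 mulrA.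
  by rewrite -expr2 sqrr_sign mul1r.
have [e ->] := basis_chainE B'.
by rewrite TE (inj_eq basis_simplex_inj) eq_sym (negPf BB') mulr0 mul0r.
Qed.

Lemma vertex_perm_bases (g : {perm E}) : g \in closure_aut f ->
  forall S : {set bergman_vertex E}, (vertex_perm g @: S \in BB) = (S \in BB).
Proof.
rewrite inE => /forallP gf S.
have g_inj : injective g by exact: perm_inj.
have fg (A : {set E}) : f (g @: A) = g @: f A by exact/eqP.
have gT : g @: [set: E] = [set: E].
  by apply/eqP; rewrite eqEcard finset.subsetT card_imset ?leqnn.
have gbases (B : {set E}) : (g @: B \in bases f) = (B \in bases f).
  rewrite [LHS]inE [RHS]inE fg -[X in _ @: _ == X]gT (inj_eq (imset_inj g_inj)).
  congr (_ && _).
  have gD i : f (g @: B :\ g i) = g @: f (B :\ i).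
    rewrite -fg; congr f; apply/setP => j; rewrite -[j](permKV g).
    by rewrite !inE mem_imset // mem_imset // !inE (inj_eq g_inj).
  apply/(independentsP f_closure)/(independentsP f_closure) =>
    [indB i iB|indB _ /imsetP[i iB ->]].
    by have := indB _ (imset_f g iB); rewrite gD mem_imset.
  by rewrite gD mem_imset // indB.
have gsimplex (B : {set E}) : vertex_perm g @: basis_simplex B = basis_simplex (g @: B).
  by rewrite !basis_simplexE vertex_perm_simplex imset0.
have vg_inj : injective (vertex_perm g) by exact: perm_inj.
apply/imsetP/imsetP => [[B Bf gS]|[B Bf ->]]; last first.
  by exists (g @: B); rewrite ?gbases.
have BE : g @: (g^-1%g @: B) = B.
  rewrite -imset_comp -[RHS]imset_id; apply: eq_imset => i /=; exact: permKV.
exists (g^-1%g @: B); first by rewrite -gbases BE.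
by apply: (imset_inj vg_inj); rewrite gS gsimplex BE.
Qed.

Lemma basis_homology i : acyclic (bergman f :\: BB) ->
  exists phi : {additive homology (bergman f) i -> chain (bergman_vertex E)},
    [/\ injective phi,
        forall c, basis_span f i c <-> exists h, phi h = c
      & forall (g : {perm E}) (g_aut : g \in closure_aut f) h,
          phi (homology_act (vertex_perm_aut g_aut) h) =
          chain_act (vertex_perm g) (phi h)].
Proof.
move=> acyc; have [phi [phi_inj phi_im phi_pi]] := homology_facet_chains
  (bergman_complex f_closure) (basis_facets f_closure) acyc i.
exists phi; split=> // [c|g g_aut h]; first by rewrite basis_spanP.
rewrite -[h]reprK homology_act_pi !phi_pi /= restrict_act //.
exact: vertex_perm_bases.
Qed.

End BasisHomology.

Theorem theorem6p1 (R : realType) (E : finType) (f : {set E} -> {set E})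
    (f_closure : closure_operator f) :
  [/\ homology_facets R (bergman f) [set basis_simplex B | B in bases f],
      (forall p : forall B : {B : {set E} | B \in bases f}, sphere R #|val B|,
         homotopy_equivalent R (realization R (bergman f)) (wedge p)),
      (finset.set0 \in bases f ->
         homotopy_equivalent R (realization R (bergman f)) (sphere R 0))
    & forall i : int,
        exists phi : {additive homology (bergman f) i ->
                               chain (bergman_vertex E)},
          [/\ injective phi,
              forall c, basis_span f i c <-> exists h, phi h = c
            & forall (g : {perm E}) (g_aut : g \in closure_aut f) h,
                phi (homology_act (vertex_perm_aut g_aut) h) =
                chain_act (vertex_perm g) (phi h)]].
Proof.
have facets_bases := basis_facets f_closure.
have bergman_c := bergman_complex f_closure.
have ind0 : finset.set0 \in independents f.
  by apply/(independentsP f_closure) => i; rewrite inE.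
have bases0 : (finset.set0 \in bases f) = (f finset.set0 == [set: E]).
  by rewrite inE ind0.
(* The main case comes first. In the other one every set spans, so only the empty set is independent
   and the realization is empty. *)
have [f0|f0] := eqVneq (f finset.set0) [set: E]; last first.
  have coll := bergmanD_bases_collapsible f_closure f0.
  have set0_bases : (finset.set0 \in bases f) = false by rewrite bases0; exact: negbTE.
  split=> [|p||i].
  - split=> //; exact/ptcontractibleW/collapsible_contractible.
  - have [B0 B0f] := bases_exist f_closure.
    pose e (B : {B | B \in bases f}) (k : 'I_#|val B|) : bergman_vertex E := inl (enum_val k).
    have facetE B : facet e B = basis_simplex (val B).
      apply/setP => v; apply/imsetP/imsetP => [[k _ ->]|[j jB ->]].
        by exists (enum_val k); rewrite ?enum_valP.
      by exists (enum_rank_in jB j); rewrite ?/e ?enum_rankK_in.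
    have facetsE : [set facet e B | B in {: {B | B \in bases f}}] =
        [set basis_simplex B | B in bases f].
      apply/setP => S; apply/imsetP/imsetP => [[B _ ->]|[B Bf ->]].
        by exists (val B); [exact: valP|exact: facetE].
      by exists (exist _ B Bf); rewrite ?facetE.
    apply: (@wedge_of_facets R _ _ _ e (bergman f) p (exist _ B0 B0f)) => //.
    + move=> B; rewrite card_gt0; apply: contraFneq set0_bases => <-; exact: valP.
    + by move=> B j k [] /enum_val_inj.
    + by move=> B C; rewrite !facetE => /basis_simplex_inj/val_inj.
    + by rewrite facetsE.
    + by rewrite facetsE; exact: collapsible_contractible.
  - by rewrite set0_bases.
  - exact/basis_homology/collapsible_acyclic.
have basesT : finset.set0 \in bases f by rewrite bases0 f0.
have fT A : f A = [set: E].
  apply/eqP; rewrite -finset.subTset -f0.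
  by case: f_closure => _ + _; apply; exact: finset.sub0set.
have bergmanD0 : bergman f :\: [set basis_simplex B | B in bases f] = finset.set0.
  by apply/setP => S; rewrite bergmanD_bases // fT eqxx andbF inE.
have bergman0 S : S \in bergman f -> S = finset.set0.
  move=> SK; rewrite (bergman_spanning f_closure SK (fT _)).
  suff -> : y_part S = finset.set0 by exact: imset0.
  apply/setP => i; rewrite [RHS]inE; apply/negbTE/negP => iS.
  move: SK; rewrite bergmanE => /and3P[/(independentsP f_closure)/(_ i iS)].
  by rewrite fT inE.
have realization0 : realization R (bergman f) -> False.
  move=> x; have [_ x1 /bergman0/setP x0] := points_realization x.
  move: x1; rewrite big1 => [/esym/eqP|v _]; first by rewrite oner_eq0.
  by apply/eqP; have := x0 v; rewrite !inE => /negbFE.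
split=> [|p|_|i].
- by split=> //; left.
(* No such [p] exists: at the empty basis it would be a point of the empty sphere. *)
- apply: (empty_homotopy_equivalent _ realization0) => _.
  by have := p (exist _ finset.set0 basesT); rewrite /= cards0 => /sphere0_empty.
- exact: (empty_homotopy_equivalent _ realization0 (@sphere0_empty R)).
- apply: basis_homology => //; rewrite bergmanD0 => j c cK _.
  exists 0; rewrite ?rpred0 // raddf0; apply/ffunP => S; rewrite ffunE.
  by apply/esym/eqP; apply: contraT => /(chainsP _ _ _ cK)[]; rewrite inE.
Qed.
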